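(* Let $X$ be an infinite-dimensional complex Banach space and $T\in L(X)$. The following statements are equivalent: (i) $\sigma_{\mathbf{gK}\mathcal M}(T)=\emptyset$; (ii) $\sigma_{\mathbf{gD}\mathcal M}(T)=\emptyset$; (iii) $T$ is polynomially meromorphic; (iv) $\sigma_{B\mathcal B}(T)$ is a finite set.
   Context: $L(X)$ is the algebra of bounded linear operators on $X$; $N(T)$, $R(T)$ are kernel and range. $(M,N)\in Red(T)$ means that $M,N$ are closed $T$-invariant subspaces with $X=M\oplus N$; $T_M$, $T_N$ are the restrictions of $T$ viewed as operators on $M$, $N$. $T$ is Kato if $R(T)$ is closed and $N(T)\subset R(T^n)$ for every $n\in\mathbb N$. An operator is meromorphic if every non-zero point of its spectrum is a pole of its resolvent. $T$ is polynomially meromorphic if there is a non-constant complex polynomial $p$ such that $p(T)$ is meromorphic. $T$ admits a generalized Kato-meromorphic decomposition if there is $(M,N)\in Red(T)$ with $T_M$ Kato and $T_N$ meromorphic. $T$ is generalized Drazin-meromorphic invertible if there is $S\in L(X)$ with $TS=ST$, $STS=S$ and $TST-T$ meromorphic. $T$ is Browder if it is Fredholm with finite ascent and finite descent. $T$ is B-Browder if there is an integer $n\ge 0$ such that $R(T^n)$ is closed and the restriction of $T$ to $R(T^n)$, viewed as a map $R(T^n)\to R(T^n)$, is Browder; it is known that this is equivalent to $T$ being Drazin invertible (finite ascent and descent). $\sigma_{\mathbf{gK}\mathcal M}(T)$, $\sigma_{\mathbf{gD}\mathcal M}(T)$, $\sigma_{B\mathcal B}(T)$ are the sets of $\lambda\in\mathbb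 C$ such that $T-\lambda I$, respectively, does not admit a generalized Kato-meromorphic decomposition, is not generalized Drazin-meromorphic invertible, is not B-Browder. *)

(* Defs.v *)
From HB Require Import structures.
From mathcomp Require Import all_boot all_order all_algebra.
From mathcomp Require Import complex.
From mathcomp Require Import all_classical all_reals all_analysis.

Set Implicit Arguments.
Unset Strict Implicit.
Unset Printing Implicit Defensive.

Import Order.TTheory GRing.Theory Num.Theory.
Import numFieldNormedType.Exports.

Local Open Scope classical_set_scope.
Local Open Scope ring_scope.

(* The scalar field K is kept abstract; the intended instance is K = R[i] with
   R : realType. *)

Record closed_subspace (K : numFieldType) (X : normedModType K) :=
  ClosedSubspace {
    cs_space :> submodClosed X;
    cs_closed : closed [set x : X | x \in cs_space] }.

(* A closed subspace as a normed space in its own right, so that the restriction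
   of an operator to it is again an operator on a normed space. *)
Definition subsp (K : numFieldType) (X : normedModType K)
  (M : closed_subspace X) := {x : X | x \in M}.

Section SubspaceNormed.
Context {K : numFieldType} {X : normedModType K} (M : closed_subspace X).

HB.instance Definition _ := SubType.on (subsp M).
HB.instance Definition _ := [Choice of subsp M by <:].
HB.instance Definition _ := [SubChoice_isSubLmodule of subsp M by <:].

Definition subsp_norm (x : subsp M) : K := `|val x|.

Lemma subsp_normD x y : subsp_norm (x + y) <= subsp_norm x + subsp_norm y.
Proof. by rewrite /subsp_norm raddfD; exact: ler_normD. Qed.

Lemma subsp_normZ (k : K) x : subsp_norm (k *: x) = `|k| * subsp_norm x.
Proof. by rewrite /subsp_norm linearZ /= normrZ. Qed.

Lemma subsp_norm_eq0 x : subsp_norm x = 0 -> x = 0.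
Proof.
by move/eqP; rewrite normr_eq0 => /eqP h; apply: val_inj; rewrite h raddf0.
Qed.

HB.instance Definition _ := @Lmodule_isNormed.Build K (subsp M)
  subsp_norm subsp_normD subsp_normZ subsp_norm_eq0.

Lemma subsp_normE (x : subsp M) : `|x| = `|val x|.
Proof. by []. Qed.

End SubspaceNormed.

Section SubspaceComplete.
Context {K : numFieldType} {X : completeNormedModType K}
  (M : closed_subspace X).

Lemma subsp_complete (F : set_system (subsp M)) :
  ProperFilter F -> cauchy F -> cvg F.
Proof.
move=> FF /cauchy_ballP Fc.
pose G : set_system X := (fun x : subsp M => val x) @ F.
have GF : ProperFilter G by exact: fmap_proper_filter.
have Gc : cauchy G.
  apply/cauchy_ballP => e e0; have [[A B] /= [FA FB] AB] := Fc e e0.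
  exists ((fun x : subsp M => val x) @` A, (fun x : subsp M => val x) @` B) => /=.
    split; [apply: filterS FA|apply: filterS FB];
      by move=> x ?; exists x.
  move=> -[_ _] /= [[a Aa <-] [b Bb <-]].
  have := AB (a, b) (conj Aa Bb).
  by rewrite -!ball_normE /ball_ /= subsp_normE raddfB.
have /cvg_ex [l Gl] : cvg G by exact: cauchy_cvg.
have Ml : l \in M.
  have := @cs_closed _ _ M; apply.
  move=> B Bl; have /filter_ex[x Bx] : F ((fun x : subsp M => val x) @^-1` B).
    exact: Gl.
  by exists (val x); split => //; exact: (valP x).
apply/cvg_ex; exists (exist _ l Ml : subsp M).
apply/cvgrPdist_lt => e e0.
move/cvgrPdist_lt : Gl => /(_ e e0) /=.
by apply: filterS => x /=; rewrite subsp_normE raddfB.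
Qed.

HB.instance Definition _ := Uniform_isComplete.Build (subsp M) subsp_complete.

End SubspaceComplete.

Section Operators.
Context {K : numFieldType}.

Section OneSpace.
Context {X : normedModType K}.
Implicit Types (T S : X -> X) (V : set X).

(* membership in L(X) *)
Definition bounded_operator T :=
  linear T /\ exists k : K, forall x, `|T x| <= k * `|x|.

Definition shift_op T (lambda : K) : X -> X := fun x => T x - lambda *: x.

Definition kernel T : set X := [set x | T x = 0].

Definition finite_dim V := exists n (e : 'I_n -> X),
  V = [set \sum_(i < n) c i *: e i | c in [set: 'I_n -> K]].

(* dim (X / V) < oo : the classes of the e i span X / V *)
Definition finite_codim V := exists n (e : 'I_n -> X),
  forall x, exists c : 'I_n -> K, V (x - \sum_(i < n) c i *: e i).

(* convergence in the operator norm *)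
Definition op_cvg (A : nat -> X -> X) T := forall e : K, 0 < e ->
  \forall n \near \oo, forall x, `|A n x - T x| <= e * `|x|.

(* S is the inverse of T in L(X) *)
Definition bounded_inverse T S :=
  [/\ bounded_operator S, cancel T S & cancel S T].

Definition spectrum T : set K :=
  [set lambda | ~ exists S, bounded_inverse (shift_op T lambda) S].

(* lambda is a pole, of order m > 0, of mu |-> (T - mu)^-1: on a punctured disc
   around lambda contained in the resolvent set, there is a Laurent expansion
     (T - mu)^-1 = \sum_(k >= 0) (mu - lambda)^(k - m) A_k,   A_0 <> 0,
   stated after multiplication by (mu - lambda)^m.  Replacing (T - mu)^-1 by
   (mu - T)^-1 only changes the sign of the A_k. *)
Definition resolvent_pole T (lambda : K) :=
  exists (m : nat) (A : nat -> X -> X) (r : K),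
  [/\ (0 < m)%N, 0 < r, forall k, bounded_operator (A k),
      exists x, A 0%N x != 0 &
      forall mu, 0 < `|mu - lambda| < r ->
      exists2 S, bounded_inverse (shift_op T mu) S &
        op_cvg (fun n x => \sum_(k < n) (mu - lambda) ^+ k *: A k x)
               (fun x => (mu - lambda) ^+ m *: S x)].

Definition meromorphic T := forall lambda,
  spectrum T lambda -> lambda != 0 -> resolvent_pole T lambda.

Definition poly_op (p : {poly K}) T : X -> X :=
  fun x => \sum_(i < size p) p`_i *: iter i T x.

Definition polynomially_meromorphic T :=
  exists p : {poly K}, (1 < size p)%N /\ meromorphic (poly_op p T).

Definition Kato T :=
  closed (range T) /\ forall n : nat, kernel T `<=` range (iter n T).

Definition Fredholm T := finite_dim (kernel T) /\ finite_codim (range T).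

Definition finite_ascent T :=
  exists n : nat, kernel (iter n T) = kernel (iter n.+1 T).

Definition finite_descent T :=
  exists n : nat, range (iter n T) = range (iter n.+1 T).

Definition Browder T := [/\ Fredholm T, finite_ascent T & finite_descent T].

Definition gD_meromorphic_invertible T := exists S : X -> X,
  [/\ bounded_operator S,
      forall x, T (S x) = S (T x),
      forall x, S (T (S x)) = S x &
      meromorphic (fun x => T (S (T x)) - T x)].

Definition invariant T (M : closed_subspace X) :=
  forall x, x \in M -> T x \in M.

Definition restr T (M : closed_subspace X) (TM : invariant T M) :
  subsp M -> subsp M :=
  fun x => exist (fun y => y \in M) (T (val x)) (TM (val x) (valP x)).

Definition direct_sum (M N : closed_subspace X) :=
  (forall x, exists y z, [/\ y \in M, z \in N & x = y + z]) /\
  (forall x, x \in M -> x \in N -> x = 0).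

End OneSpace.

Section Decompositions.
Context {X : normedModType K}.
Implicit Types T : X -> X.

Definition gK_meromorphic_decomposable T :=
  exists (M N : closed_subspace X) (TM : invariant T M) (TN : invariant T N),
  [/\ direct_sum M N, Kato (restr TM) & meromorphic (restr TN)].

Definition B_Browder T :=
  exists (n : nat) (M : closed_subspace X) (TM : invariant T M),
  [set x : X | x \in M] = range (iter n T) /\ Browder (restr TM).

Definition gKM_spectrum T : set K :=
  [set lambda | ~ gK_meromorphic_decomposable (shift_op T lambda)].

Definition gDM_spectrum T : set K :=
  [set lambda | ~ gD_meromorphic_invertible (shift_op T lambda)].

Definition BB_spectrum T : set K :=
  [set lambda | ~ B_Browder (shift_op T lambda)].

End Decompositions.

End Operators.

(* Main.v *)
(* Everything rests on Drazin invertibility in the form U^m = U^(m+1) B with B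
   bounded and commuting with U.  Comparing Laurent coefficients, T is
   meromorphic iff T - l is Drazin invertible for all l <> 0; by the open mapping
   theorem, B-Browder operators are exactly the Drazin invertible ones.
   - If p(T) is meromorphic, split p - p(l) as (z - l)^k q with q(l) <> 0:
     Bezout shows that T - l is Drazin invertible unless p(l) = 0, so only
     finitely many points remain.  Conversely, if s lists the bad points, then
     with p = z * prod_(a <- s) (z - a) every p(T) - c with c <> 0 is a product
     of Drazin invertible factors.
   - If only finitely many points are bad, some small circle around a given
     point l avoids the spectrum; its Riesz projection splits T - l into an
     invertible and a meromorphic part.  The projection is the limit of
     (1 - A^(2^k))^-1, where A is T - l divided by the radius of the circle.
   - If T - l = Kato + meromorphic for all l, the closure of the resolvent set is
     open: a Kato operator that is a limit of invertible operators U - z, z -> 0,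
     is itself invertible, so near a point of that closure all T - w with w <> l
     are Drazin invertible, hence limits of invertible operators.  By
     connectedness this closure is the whole plane, every Kato part is
     invertible, and compactness of discs leaves finitely many bad points. *)

(* No contour integral is used. The average of (1 - w A)^-1 over the n-th roots of unity w equals (1
   - A^n)^-1, and it is a Riemann sum of the Cauchy integral for the Riesz projection. For n = 2^k,
   each doubling is one average over two square roots; it multiplies a Lipschitz constant of the
   resolvent on the circle by 3/4, so the limit exists with a geometric rate. Limits of vectors and
   operators carry such rates throughout, and equalities follow from estimates by c q^n. The
   equation U^m = U^(m+1) B is algebraic: products, coprime factors and direct sums are handled
   without analysis. Since B is only known to commute with U, it is first replaced by an element of
   the bicommutant. For a Kato operator U, a kernel vector x_0 extends to a backward orbit U x_(k+1)
   = x_k of at most geometric growth. Then the sum of z^k x_k would be an eigenvector of U for every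
   small z, which is impossible when some such U - z is invertible. *)
Require Import Defs.
From HB Require Import structures.
From mathcomp Require Import all_boot all_order all_algebra.
From mathcomp Require Import complex.
From mathcomp Require Import all_classical all_reals all_analysis.
From mathcomp Require Import ring lra.

Set Implicit Arguments.
Unset Strict Implicit.
Unset Printing Implicit Defensive.

Import Order.TTheory GRing.Theory Num.Theory.
Import numFieldNormedType.Exports.

Local Open Scope classical_set_scope.
Local Open Scope ring_scope.

(* The norm of a normed space over R[i] takes values in R[i], which is only
   partially ordered; rnorm is the same norm with values in R. *)
Definition rnorm {R : realType} {V : normedZmodType R[i]} (x : V) : R :=
  complex.Re `|x|.

Section RealNorm.
Context {R : realType}.

Lemma normE (V : normedZmodType R[i]) (x : V) : `|x| = (rnorm x)%:C%C.
Proof. by rewrite /rnorm RRe_real // normr_real. Qed.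

Lemma rnorm_ge0 (V : normedZmodType R[i]) (x : V) : 0 <= rnorm x.
Proof. by rewrite -lecR -normE normr_ge0. Qed.

Lemma rnorm0 (V : normedZmodType R[i]) : rnorm (0 : V) = 0.
Proof. by rewrite /rnorm normr0. Qed.

Lemma rnorm0_eq0 (V : normedZmodType R[i]) (x : V) : rnorm x <= 0 -> x = 0.
Proof.
move=> h; apply/eqP; rewrite -normr_eq0 normE; apply/eqP; congr (_%:C)%C.
by apply/eqP; rewrite eq_le h rnorm_ge0.
Qed.

Lemma rnorm_gt0 (V : normedZmodType R[i]) (x : V) : (0 < rnorm x) = (x != 0).
Proof. by rewrite -ltcR -normE normr_gt0. Qed.

Lemma rnormN (V : normedZmodType R[i]) (x : V) : rnorm (- x) = rnorm x.
Proof. by rewrite /rnorm normrN. Qed.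

Lemma rnormB (V : normedZmodType R[i]) (x y : V) : rnorm (x - y) = rnorm (y - x).
Proof. by rewrite /rnorm distrC. Qed.

Lemma rnormD_le (V : normedZmodType R[i]) (x y : V) : rnorm (x + y) <= rnorm x + rnorm y.
Proof. by rewrite -lecR rmorphD /= -!normE ler_normD. Qed.

Lemma rnormB_le (V : normedZmodType R[i]) (x y : V) : rnorm (x - y) <= rnorm x + rnorm y.
Proof. by rewrite (le_trans (rnormD_le _ _))// rnormN. Qed.

Lemma rnorm_dist (V : normedZmodType R[i]) (x y z : V) :
  rnorm (x - z) <= rnorm (x - y) + rnorm (y - z).
Proof. by rewrite (le_trans _ (rnormD_le _ _))// addrA subrK. Qed.

Lemma rnormZ (V : normedModType R[i]) (k : R[i]) (x : V) :
  rnorm (k *: x) = rnorm k * rnorm x.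
Proof. by apply: complexI; rewrite rmorphM /= -!normE normrZ. Qed.

Lemma rnormM (k l : R[i]) : rnorm (k * l) = rnorm k * rnorm l.
Proof. by apply: complexI; rewrite rmorphM /= -!normE normrM. Qed.

Lemma rnormV (k : R[i]) : rnorm k^-1 = (rnorm k)^-1.
Proof. by apply: complexI; rewrite fmorphV /= -!normE normfV. Qed.

Lemma rnormX (k : R[i]) n : rnorm (k ^+ n) = rnorm k ^+ n.
Proof. by apply: complexI; rewrite rmorphXn /= -!normE normrX. Qed.

Lemma rnorm1 : rnorm (1 : R[i]) = 1.
Proof. by rewrite /rnorm normr1. Qed.

Lemma rnorm_real (r : R) : rnorm (r%:C%C) = `|r|.
Proof.
by rewrite /rnorm normc_def /= expr0n /= addr0 sqrtr_sqr.
Qed.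

Lemma rnorm2 : rnorm (2 : R[i]) = 2.
Proof. by rewrite -(rmorph_nat (real_complex R) 2) rnorm_real ger0_norm. Qed.

Lemma rnormE (z : R[i]) : rnorm z ^+ 2 = complex.Re z ^+ 2 + complex.Im z ^+ 2.
Proof. by rewrite /rnorm normc_def /= sqr_sqrtr // addr_ge0 // sqr_ge0. Qed.

Lemma rnorm_Re_Im (z : R[i]) :
  rnorm z <= `|complex.Re z| + `|complex.Im z|.
Proof.
rewrite -(@ler_pXn2r _ 2) ?nnegrE ?rnorm_ge0 ?addr_ge0 //.
rewrite rnormE -[complex.Re z ^+ 2]real_normK ?num_real //.
rewrite -[complex.Im z ^+ 2]real_normK ?num_real // sqrrD addrAC lerDl.
by rewrite mulrn_wge0 // mulr_ge0.
Qed.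

Lemma Re_le_rnorm (z : R[i]) : `|complex.Re z| <= rnorm z.
Proof.
rewrite -(@ler_pXn2r _ 2) ?nnegrE ?rnorm_ge0 //.
by rewrite rnormE real_normK ?num_real // lerDl sqr_ge0.
Qed.

Lemma Im_le_rnorm (z : R[i]) : `|complex.Im z| <= rnorm z.
Proof.
rewrite -(@ler_pXn2r _ 2) ?nnegrE ?rnorm_ge0 //.
by rewrite rnormE real_normK ?num_real // lerDr sqr_ge0.
Qed.

Lemma rnorm_parallelogram (z w : R[i]) :
  rnorm (z + w) ^+ 2 + rnorm (z - w) ^+ 2 = 2 * (rnorm z ^+ 2 + rnorm w ^+ 2).
Proof. by rewrite !rnormE; case: z w => [a b] [c d] /=; ring. Qed.

End RealNorm.

(** * Convergence at a geometric rate *)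

Section Geometric.
Context {R : realType}.

Lemma geometric_small (c q e : R) : 0 <= q < 1 -> 0 < e ->
  exists N, forall n, (N <= n)%N -> c * q ^+ n < e.
Proof.
move=> /andP[q0 q1] e0.
have : (fun n => c * q ^+ n) @ \oo --> c * 0.
  apply: cvgM; first exact: cvg_cst.
  by apply: cvg_expr; rewrite ger0_norm.
rewrite mulr0 => /cvgrPdist_lt /(_ e e0) [N _ h]; exists N => n Nn.
by have := h n Nn; rewrite /= sub0r normrN; apply: le_lt_trans; exact: ler_norm.
Qed.

(** The substitute for passing to the limit: applied to the norm of a difference, it turns an error
    bound valid for all [n] into an equality. *)
Lemma le0_geometric (x c q : R) : 0 <= q < 1 ->
  (forall n, x <= c * q ^+ n) -> x <= 0.
Proof.
move=> hq h; rewrite leNgt; apply/negP => x0.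
have [N /(_ N (leqnn _))] := @geometric_small c q x hq x0.
by rewrite ltNge h.
Qed.

Lemma geometric_dist (V : normedZmodType R[i]) (u : nat -> V) (c q : R) :
  0 <= q < 1 -> (forall n, rnorm (u n.+1 - u n) <= c * q ^+ n) ->
  forall n m, (n <= m)%N -> rnorm (u m - u n) <= c / (1 - q) * q ^+ n.
Proof.
move=> /andP[q0 q1] h n m /subnK <-; have q1' : 1 - q != 0 by lra.
have c0 : 0 <= c.
  by have := h 0%N; rewrite expr0 mulr1; apply: le_trans; exact: rnorm_ge0.
(* The extra factor is the exact partial geometric sum, which makes the induction on [m - n]
   close. *)
suff : rnorm (u (m - n + n)%N - u n) <= c / (1 - q) * q ^+ n * (1 - q ^+ (m - n)).
  move=> /le_trans; apply; rewrite ler_piMr //; last by rewrite gerBl exprn_ge0.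
  by rewrite !mulr_ge0 ?exprn_ge0 ?invr_ge0 //; lra.
elim: (m - n)%N => [|k IH]; first by rewrite add0n subrr rnorm0 expr0 subrr mulr0.
rewrite addSn (le_trans (rnorm_dist _ (u (k + n)%N) _)) //.
rewrite (le_trans (lerD (h _) IH)) // exprD exprS.
rewrite le_eqVlt; apply/orP; left; apply/eqP.
set x := q ^+ k; set y := q ^+ n; rewrite -[in LHS](mulfVK q1' (c * _)).
by field.
Qed.

Lemma geometric_cvg (X : completeNormedModType R[i]) (u : nat -> X) (c q : R) :
  0 <= q < 1 -> (forall n, rnorm (u n.+1 - u n) <= c * q ^+ n) ->
  exists l, forall n, rnorm (u n - l) <= c / (1 - q) * q ^+ n.
Proof.
move=> hq h; have hd := geometric_dist hq h.
have : cauchy (u @ \oo).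
  apply/cauchy_ballP => e e0.
  have ee : e = (complex.Re e)%:C%C by rewrite RRe_real // gtr0_real.
  have re0 : 0 < complex.Re e by rewrite -ltcR -ee.
  have [|N hN] := @geometric_small (c / (1 - q)) q (complex.Re e / 2) hq.
    by rewrite divr_gt0.
  have uN n : (N <= n)%N -> rnorm (u n - u N) < complex.Re e / 2.
    by move=> Nn; apply: le_lt_trans (hN N (leqnn _)); exact: hd.
  exists (u @` [set n | (N <= n)%N], u @` [set n | (N <= n)%N]) => /=.
    by split; exists N => // n Nn; exists n.
  move=> -[_ _] /= [[a Na <-] [b Nb <-]].
  rewrite -ball_normE /ball_ /= normE ee ltcR.
  rewrite (le_lt_trans (rnorm_dist _ (u N) _)) // [ltRHS]splitr ltrD ?uN //.
  by rewrite rnormB uN.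
move=> /cauchy_cvg /cvg_ex [l ul]; exists l => n.
apply/ler_addgt0Pr => e e0.
move/cvgrPdist_lt : ul => /(_ e%:C%C); rewrite ltcR => /(_ e0) [N _ hN].
have := hN (maxn N n) (leq_maxl _ _); rewrite /= normE ltcR => /ltW h1.
rewrite (le_trans (rnorm_dist _ (u (maxn N n)) _)) // lerD //.
  by rewrite rnormB hd // leq_maxr.
by rewrite rnormB.
Qed.

End Geometric.

(** * Bounded operators *)

(** An inequality in [R[i]] compares real parts and forces equal imaginary parts, so the absolute
    value of the real part of a complex bound is a real bound. *)
Lemma bounded_operatorP (R : realType) (X Y : normedModType R[i]) (f : X -> Y) :
  (exists k : R[i], forall x, `|f x| <= k * `|x|) <->
  (exists2 k : R, 0 <= k & forall x, rnorm (f x) <= k * rnorm x).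
Proof.
split=> [[k fk]|[k k0 fk]]; last first.
  by exists k%:C%C => x; rewrite !normE -rmorphM /= lecR.
exists `|complex.Re k| => // x; have := fk x; rewrite !normE lecE => /andP[_].
have -> : complex.Re (k * (rnorm x)%:C%C) = complex.Re k * rnorm x.
  by case: k {fk} => a b /=; rewrite mulr0 subr0.
by move=> /le_trans; apply; rewrite ler_wpM2r ?rnorm_ge0 ?ler_norm.
Qed.

Section BoundedOperators.
Context {R : realType} (X : normedModType R[i]).

Record bop := Bop { bop_fun :> X -> X; bopP : bounded_operator bop_fun }.

Implicit Types (a b c : bop) (x y : X).

Lemma bopE a b : a =1 b -> a = b.
Proof.
case: a b => [a pa] [b pb] /= /funext ab; rewrite ab in pa *.
by congr Bop; exact: Prop_irrelevance.
Qed.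

Lemma bopD a x y : a (x + y) = a x + a y.
Proof. by have [h _] := bopP a; have := h 1 x y; rewrite !scale1r. Qed.

Lemma bop0 a : a 0 = 0.
Proof. by apply: (addrI (a 0)); rewrite -bopD !addr0. Qed.

Lemma bopZ a k x : a (k *: x) = k *: a x.
Proof. by have [h _] := bopP a; have := h k x 0; rewrite !addr0 bop0 addr0. Qed.

Lemma bopN a x : a (- x) = - a x.
Proof. by rewrite -scaleN1r bopZ scaleN1r. Qed.

Lemma bopB a x y : a (x - y) = a x - a y.
Proof. by rewrite bopD bopN. Qed.

Lemma bop_bound a : exists2 k, 0 <= k & forall x, rnorm (a x) <= k * rnorm x.
Proof. by have [_ /bounded_operatorP] := bopP a. Qed.

Lemma mk_bop_subproof (f : X -> X) (k : R) : linear f ->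
  (forall x, rnorm (f x) <= k * rnorm x) -> bounded_operator f.
Proof.
move=> lf fk; split=> //; apply/bounded_operatorP; exists `|k| => // x.
by rewrite (le_trans (fk x)) // ler_wpM2r ?rnorm_ge0 ?ler_norm.
Qed.

Lemma bop_zero_subproof : bounded_operator (fun _ : X => 0 : X).
Proof.
apply: (@mk_bop_subproof _ 0) => [k x y|x]; first by rewrite scaler0 addr0.
by rewrite rnorm0 mul0r.
Qed.

Lemma bop_one_subproof : bounded_operator (fun x : X => x).
Proof. by apply: (@mk_bop_subproof _ 1) => // x; rewrite mul1r. Qed.

Lemma bop_add_subproof a b : bounded_operator (fun x => a x + b x).
Proof.
have [k k0 ak] := bop_bound a; have [l l0 bl] := bop_bound b.
apply: (@mk_bop_subproof _ (k + l)) => [c x y|x].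
  by rewrite !bopD !bopZ scalerDr addrACA.
by rewrite (le_trans (rnormD_le _ _)) // mulrDl lerD.
Qed.

Lemma bop_opp_subproof a : bounded_operator (fun x => - a x).
Proof.
have [k k0 ak] := bop_bound a.
apply: (@mk_bop_subproof _ k) => [c x y|x]; last by rewrite rnormN.
by rewrite bopD bopZ opprD scalerN.
Qed.

Lemma bop_mul_subproof a b : bounded_operator (fun x => a (b x)).
Proof.
have [k k0 ak] := bop_bound a; have [l l0 bl] := bop_bound b.
apply: (@mk_bop_subproof _ (k * l)) => [c x y|x]; first by rewrite !bopD !bopZ.
by rewrite (le_trans (ak _)) // -mulrA ler_wpM2l.
Qed.

Lemma bop_scale_subproof (k : R[i]) a : bounded_operator (fun x => k *: a x).
Proof.
have [l l0 al] := bop_bound a.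
apply: (@mk_bop_subproof _ (rnorm k * l)) => [c x y|x].
  by rewrite bopD bopZ scalerDr !scalerA mulrC.
by rewrite rnormZ -mulrA ler_wpM2l ?rnorm_ge0.
Qed.

HB.instance Definition _ := gen_eqMixin bop.
HB.instance Definition _ := gen_choiceMixin bop.

Let addA : associative (fun a b => Bop (bop_add_subproof a b)).
Proof. by move=> a b c; apply: bopE => x /=; rewrite addrA. Qed.
Let addC : commutative (fun a b => Bop (bop_add_subproof a b)).
Proof. by move=> a b; apply: bopE => x /=; rewrite addrC. Qed.
Let add0 : left_id (Bop bop_zero_subproof) (fun a b => Bop (bop_add_subproof a b)).
Proof. by move=> a; apply: bopE => x /=; rewrite add0r. Qed.
Let addN : left_inverse (Bop bop_zero_subproof) (fun a => Bop (bop_opp_subproof a))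
  (fun a b => Bop (bop_add_subproof a b)).
Proof. by move=> a; apply: bopE => x /=; rewrite addNr. Qed.

HB.instance Definition _ := GRing.isZmodule.Build bop addA addC add0 addN.

Let mulA : associative (fun a b => Bop (bop_mul_subproof a b)).
Proof. by move=> a b c; apply: bopE. Qed.
Let mul1 : left_id (Bop bop_one_subproof) (fun a b => Bop (bop_mul_subproof a b)).
Proof. by move=> a; apply: bopE. Qed.
Let mulr1' : right_id (Bop bop_one_subproof) (fun a b => Bop (bop_mul_subproof a b)).
Proof. by move=> a; apply: bopE. Qed.
Let mulDl : left_distributive (fun a b => Bop (bop_mul_subproof a b)) +%R.
Proof. by move=> a b c; apply: bopE. Qed.
Let mulDr : right_distributive (fun a b => Bop (bop_mul_subproof a b)) +%R.
Proof. by move=> a b c; apply: bopE => x /=; rewrite bopD. Qed.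

(** The ring may be trivial: in a direct sum one summand can be the zero space, on which 1 = 0. *)
HB.instance Definition _ := GRing.Zmodule_isPzRing.Build bop mulA mul1 mulr1' mulDl mulDr.

Let scaleA k l a : Bop (bop_scale_subproof k (Bop (bop_scale_subproof l a)))
  = Bop (bop_scale_subproof (k * l) a).
Proof. by apply: bopE => x /=; rewrite scalerA. Qed.
Let scale1 : left_id 1 (fun k a => Bop (bop_scale_subproof k a)).
Proof. by move=> a; apply: bopE => x /=; rewrite scale1r. Qed.
Let scaleDr : right_distributive (fun k a => Bop (bop_scale_subproof k a)) +%R.
Proof. by move=> k a b; apply: bopE => x /=; rewrite scalerDr. Qed.
Let scaleDl a : {morph (fun k => Bop (bop_scale_subproof k a)) : k l / k + l}.
Proof. by move=> k l; apply: bopE => x /=; rewrite scalerDl. Qed.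

HB.instance Definition _ := GRing.Zmodule_isLmodule.Build R[i] bop
  scaleA scale1 scaleDr scaleDl.

Lemma bop_mulE a b x : (a * b) x = a (b x). Proof. by []. Qed.
Lemma bop_scaleE k a x : (k *: a) x = k *: a x. Proof. by []. Qed.
Lemma bop_oneE x : (1 : bop) x = x. Proof. by []. Qed.
Lemma bop_zeroE x : (0 : bop) x = 0. Proof. by []. Qed.

Lemma bop_expE a n x : (a ^+ n) x = iter n a x.
Proof. by elim: n => [//|n IH]; rewrite exprS bop_mulE IH. Qed.

Lemma bop_scaleAl k a b : k *: (a * b) = (k *: a) * b.
Proof. exact: bopE. Qed.

Lemma bop_scaleAr k a b : k *: (a * b) = a * (k *: b).
Proof. by apply: bopE => x; rewrite !bop_mulE !bop_scaleE bopZ. Qed.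

(** An infimum of bounds needs no unit vector and so covers the zero space; there [opn 1] is 0,
    which is why [opn1] is an inequality. *)
Definition opn a : R := inf [set k | 0 <= k /\ forall x, rnorm (a x) <= k * rnorm x].

Lemma opn_has_inf a :
  has_inf [set k | 0 <= k /\ forall x, rnorm (a x) <= k * rnorm x].
Proof.
by split; [have [k k0 ak] := bop_bound a; exists k | exists 0 => k []].
Qed.

Lemma opn_ge0 a : 0 <= opn a.
Proof. by apply: lb_le_inf => [|k []//]; have [] := opn_has_inf a. Qed.

Lemma opnP a x : rnorm (a x) <= opn a * rnorm x.
Proof.
have [x0|x0] := leP (rnorm x) 0.
  by rewrite (rnorm0_eq0 x0) bop0 rnorm0 mulr0.
rewrite -ler_pdivrMr //; apply: lb_le_inf => [|k [_ h]].
  by have [] := opn_has_inf a.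
by rewrite ler_pdivrMr.
Qed.

Lemma opn_le a k : 0 <= k -> (forall x, rnorm (a x) <= k * rnorm x) -> opn a <= k.
Proof. by move=> k0 h; apply: ge_inf => //; have [] := opn_has_inf a. Qed.

Lemma opn0_eq0 a : opn a <= 0 -> a = 0.
Proof.
move=> h; apply: bopE => x; apply: rnorm0_eq0.
by rewrite (le_trans (opnP _ _)) // mulr_le0_ge0 // rnorm_ge0.
Qed.

Lemma opn0 : opn 0 = 0.
Proof.
apply/eqP; rewrite eq_le opn_ge0 andbT; apply: opn_le => // x.
by rewrite rnorm0 mul0r.
Qed.

Lemma opnD a b : opn (a + b) <= opn a + opn b.
Proof.
apply: opn_le => [|x]; first by rewrite addr_ge0 ?opn_ge0.
by rewrite (le_trans (rnormD_le _ _)) // mulrDl lerD // opnP.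
Qed.

Lemma opnM a b : opn (a * b) <= opn a * opn b.
Proof.
apply: opn_le => [|x]; first by rewrite mulr_ge0 ?opn_ge0.
by rewrite (le_trans (opnP a (b x))) // -mulrA ler_wpM2l ?opn_ge0 ?opnP.
Qed.

Lemma opnZ k a : opn (k *: a) <= rnorm k * opn a.
Proof.
apply: opn_le => [|x]; first by rewrite mulr_ge0 ?opn_ge0 ?rnorm_ge0.
by rewrite rnormZ -mulrA ler_wpM2l ?rnorm_ge0 ?opnP.
Qed.

Lemma opnN a : opn (- a) = opn a.
Proof.
have h b : opn (- b) <= opn b.
  by rewrite -scaleN1r (le_trans (opnZ _ _)) // rnormN rnorm1 mul1r.
by apply/eqP; rewrite eq_le h -{1}[a]opprK h.
Qed.

Lemma opn1 : opn 1 <= 1.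
Proof. by apply: opn_le => // x; rewrite mul1r. Qed.

End BoundedOperators.

Lemma bop_geometric_cvg (R : realType) (X : completeNormedModType R[i])
    (u : nat -> bop X) (c q : R) : 0 <= q < 1 ->
  (forall n, opn (u n.+1 - u n) <= c * q ^+ n) ->
  exists l : bop X, forall n, opn (u n - l) <= c / (1 - q) * q ^+ n.
Proof.
move=> hq h; have [q0 q1] := andP hq.
have c0 : 0 <= c.
  by have := h 0%N; rewrite expr0 mulr1; apply: le_trans; exact: opn_ge0.
have cq0 : 0 <= c / (1 - q) by rewrite divr_ge0 // subr_ge0 ltW.
have ux x : exists l, forall n,
    rnorm (u n x - l) <= c * rnorm x / (1 - q) * q ^+ n.
  apply: geometric_cvg => // n; rewrite -[u n.+1 x - u n x]/((u n.+1 - u n) x).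
  by rewrite (le_trans (opnP _ _)) // mulrAC ler_wpM2r ?rnorm_ge0.
have [l ul] := choice ux.
(* Any vector approached at rate [q] is the limit, whatever the constant; linearity of [l] follows
   by exhibiting such a constant. *)
have uniq x y : (exists C, forall n, rnorm (u n x - y) <= C * q ^+ n) -> y = l x.
  move=> [C hC]; apply/eqP; rewrite -subr_eq0; apply/eqP; apply: rnorm0_eq0.
  apply: (@le0_geometric _ _ (C + c * rnorm x / (1 - q)) q hq) => n.
  rewrite (le_trans (rnorm_dist _ (u n x) _)) // mulrDl lerD //.
  by rewrite rnormB.
have lb : bounded_operator l.
  apply: (@mk_bop_subproof _ _ _ (c / (1 - q) + opn (u 0%N))) => [k x y|x].
    symmetry; apply: uniq.
    exists (rnorm k * (c * rnorm x / (1 - q)) + c * rnorm y / (1 - q)) => n.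
    rewrite bopD bopZ opprD addrACA -scalerBr (le_trans (rnormD_le _ _)) //.
    by rewrite rnormZ mulrDl -mulrA lerD // ler_wpM2l ?rnorm_ge0.
  rewrite -[l x](subrK (u 0%N x)) (le_trans (rnormD_le _ _)) // mulrDl lerD //.
    by rewrite rnormB (le_trans (ul x 0%N)) // expr0 mulr1 mulrAC.
  exact: opnP.
exists (Bop lb) => n; apply: opn_le => [|x]; first by rewrite mulr_ge0 ?exprn_ge0.
rewrite (le_trans (ul x n)) // le_eqVlt; apply/orP; left; apply/eqP; ring.
Qed.

(** * Drazin invertibility *)

Lemma drazin_exp_le (A : pzRingType) (u b : A) m n : (m <= n)%N ->
  u ^+ m = u ^+ m.+1 * b -> u ^+ n = u ^+ n.+1 * b.
Proof. by move=> /subnK <- h; rewrite exprD h -addnS exprD mulrA. Qed.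

Section CommutativeDrazin.
Context {A : comPzRingType}.
Implicit Types (a b u p d : A).

(** In a commutative ring this one equation already yields the spectral idempotent and the Drazin
    inverse, see [drazinP]. *)
Definition drazin u := exists m b, u ^+ m = u ^+ m.+1 * b.

Definition regular u := exists v, u * v = 1.

Lemma regular_drazin u : regular u -> drazin u.
Proof. by move=> [v uv]; exists 0%N, v; rewrite expr0 expr1 uv. Qed.

(* p is the projection onto the range of u ^+ m along its kernel and d the
   Drazin inverse of u. *)
Lemma drazinP u : drazin u <->
  exists m p d, [/\ p * p = p, u ^+ m * (1 - p) = 0, u * d = p & d * p = d].
Proof.
split=> [[m [b ub]]|[m [p [d [pp up ud dp]]]]]; last first.
  exists m, d; rewrite exprSr -mulrA ud; apply/eqP; rewrite -subr_eq0.
  by rewrite -[X in X - _]mulr1 -mulrBr up.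
have ubk k : u ^+ m = u ^+ m * (u ^+ k * b ^+ k).
  elim: k => [|k IH]; first by rewrite !expr0 !mulr1.
  by rewrite {1}IH {1}ub !exprS; ring.
have pp : u ^+ m * b ^+ m * (u ^+ m * b ^+ m) = u ^+ m * b ^+ m.
  by rewrite [in RHS](ubk m); ring.
exists m, (u ^+ m * b ^+ m), (b * (u ^+ m * b ^+ m)); split=> //.
- by rewrite mulrBr mulr1 -ubk subrr.
- by rewrite mulrA mulrAC [in RHS]ub exprS; ring.
- by rewrite -mulrA pp.
Qed.

Lemma drazinM u v : drazin u -> drazin v -> drazin (u * v).
Proof.
move=> [m [a ua]] [n [b vb]]; exists (maxn m n), (a * b).
rewrite !exprMn (drazin_exp_le (leq_maxl m n) ua).
by rewrite (drazin_exp_le (leq_maxr m n) vb); ring.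
Qed.

Lemma drazinX u n : drazin (u ^+ n.+1) -> drazin u.
Proof.
move=> [m [b ub]]; exists (n.+1 * m)%N, (u ^+ n * b).
by rewrite exprM ub -!exprM mulnS exprD [in RHS]exprS; rewrite exprS; ring.
Qed.

(* For coprime factors, [u^m = u^m (x u^(m+1) + y v^m)] and [u^m v^m] is a
   multiple of [(u v)^(m+1)]. *)
Lemma drazin_coprime_factor u v :
  (forall m n, exists x y, x * u ^+ m + y * v ^+ n = 1) ->
  drazin (u * v) -> drazin u.
Proof.
move=> cop [m [b uvb]]; have [x [y xy]] := cop m.+1 m.
exists m, (u ^+ m * x + y * v ^+ m.+1 * b).
rewrite -[LHS]mulr1 -xy mulrDr.
have -> : u ^+ m * (y * v ^+ m) = y * (u * v) ^+ m by rewrite exprMn; ring.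
by rewrite uvb exprMn; rewrite !exprS; ring.
Qed.

(** The components on [p] and [1 - p] multiply independently, so powers and quasi-inverses are taken
    componentwise. *)
Lemma drazin_split u a b p : p * p = p -> u = a * p + b * (1 - p) ->
  drazin a -> drazin b -> drazin u.
Proof.
move=> pp -> [m [c ac]] [n [d bd]].
have q : (1 - p) * (1 - p) = 1 - p by rewrite mulrBr mulr1 mulrBl mul1r pp; ring.
have E k : (a * p + b * (1 - p)) ^+ k.+1 = a ^+ k.+1 * p + b ^+ k.+1 * (1 - p).
  elim: k => [|k IH]; first by rewrite !expr1.
  have pq : p * (1 - p) = 0 by rewrite mulrBr pp mulr1 subrr.
  rewrite exprS IH !(exprS _ k.+1).
  rewrite (_ : (_ + _) * _ = a * a ^+ k.+1 * (p * p) +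
    b * b ^+ k.+1 * ((1 - p) * (1 - p)) +
    (a * b ^+ k.+1 + b * a ^+ k.+1) * (p * (1 - p))); last by ring.
  by rewrite pp q pq mulr0 addr0.
exists (maxn m n).+1, (c * p + d * (1 - p)).
have ha := drazin_exp_le (leqW (leq_maxl m n)) ac.
have hb := drazin_exp_le (leqW (leq_maxr m n)) bd.
have pq : p * (1 - p) = 0 by rewrite mulrBr pp mulr1 subrr.
rewrite !E.
rewrite (_ : (_ + _) * (_ + _) = a ^+ (maxn m n).+2 * c * (p * p) +
   b ^+ (maxn m n).+2 * d * ((1 - p) * (1 - p)) +
  (a ^+ (maxn m n).+2 * d + b ^+ (maxn m n).+2 * c) * (p * (1 - p)));
  last by ring.
by rewrite pp q pq mulr0 addr0 -ha -hb.
Qed.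

End CommutativeDrazin.

(** An arbitrary [b] may fail to commute with the commutant of [u], but its compression by the
    idempotent [u ^+ m * b ^+ m] is the Drazin inverse, which is determined by [u] and commutes with
    everything [u] commutes with. *)
Lemma drazin_bicommutant (A : pzRingType) (u b : A) m :
  u * b = b * u -> u ^+ m = u ^+ m.+1 * b ->
  exists2 d, u ^+ m = u ^+ m.+1 * d & forall c, c * u = u * c -> d * c = c * d.
Proof.
move=> cub ub; have cu n : GRing.comm (u ^+ n) (b ^+ n).
  by apply: commrX; apply/commr_sym/commrX/commr_sym.
have cbu k l : GRing.comm (b ^+ k) (u ^+ l).
  by apply: commrX; apply/commr_sym; apply: commrX.
have ubk k : u ^+ m * (u ^+ k * b ^+ k) = u ^+ m.
  elim: k => [|k IH]; first by rewrite !expr0 !mulr1.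
  have ukb : u ^+ k * b = b * u ^+ k by exact/commr_sym/(cbu 1%N).
  rewrite exprS [b ^+ _]exprS -!mulrA [u ^+ k * (b * _)]mulrA ukb -mulrA.
  by rewrite mulrA -exprSr mulrA -ub IH.
pose p := u ^+ m * b ^+ m.
have up : u ^+ m * p = u ^+ m by exact: ubk.
have pE : p = b ^+ m * u ^+ m by rewrite /p cu.
have pu : p * u ^+ m = u ^+ m by rewrite /p -mulrA -cu -/p up.
have pp : p * p = p by rewrite {1}pE -mulrA up -pE.
(* Both sides equal [p * c * p]: [u ^+ m] passes through [c] and absorbs [p] on either side. *)
have pc c : c * u = u * c -> c * p = p * c.
  move=> cc; have cum : c * u ^+ m = u ^+ m * c by apply: commrX.
  have -> : c * p = p * c * p.
    by rewrite {1}/p mulrA cum -pu -!mulrA; rewrite [u ^+ m * (c * _)]mulrA -cum -mulrA.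
  by rewrite {2}pE pE -!mulrA -cum -pE [u ^+ m * (c * p)]mulrA -cum -mulrA up.
have bp : b * p = p * b by apply: pc.
have ubp : u * (b * p) = p.
  by rewrite [b * p]bp /p -!mulrA -exprSr exprS !mulrA -exprS -ub.
exists (b * p); first by rewrite exprSr -mulrA ubp up.
have dp : b * p * p = b * p by rewrite -mulrA pp.
have pd : p * (b * p) = b * p by rewrite mulrA -bp -mulrA pp.
have du : b * p * u = p by rewrite -mulrA -[p * u]pc // mulrA -cub -mulrA ubp.
move: (b * p) ubp dp pd du => d ud dp pd du c cc.
have -> : d * c = d * c * p by rewrite -mulrA pc // mulrA dp.
by rewrite -ud mulrA -[d * c * u]mulrA cc mulrA du -pc // -mulrA pd.
Qed.

(** * Commutative Banach algebras of operators *)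

Record commuting (R : realType) (X : normedModType R[i]) := Commuting {
  commuting_set :> bop X -> Prop;
  commutingP : forall a b, commuting_set a -> commuting_set b -> a * b = b * a }.

(* The bicommutant of a commuting family is a commutative Banach algebra that
   contains the inverses and the Drazin inverses of its elements: spectral
   properties in L(X) can be computed there with the ring tactic. *)
Definition bicommutant (R : realType) (X : normedModType R[i])
    (G : commuting X) : {pred bop X} :=
  [pred a | `[< forall c, (forall g, G g -> c * g = g * c) -> a * c = c * a >]].

Section BicommutantAlgebra.
Context {R : realType} {X : normedModType R[i]} (G : commuting X).

Lemma bicommutant_subring : subring_closed (bicommutant G).
Proof.
split=> [|a b /asboolP ha /asboolP hb|a b /asboolP ha /asboolP hb].
- by apply/asboolP => c _; rewrite mulr1 mul1r.
- by apply/asboolP => c hc; rewrite mulrBl mulrBr ha // hb.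
- by apply/asboolP => c hc; rewrite -mulrA hb // mulrA ha // mulrA.
Qed.

Lemma bicommutant_submod : GRing.submod_closed (bicommutant G).
Proof.
split=> [|k a b /asboolP ha /asboolP hb]; apply/asboolP => c hc.
  by rewrite mul0r mulr0.
by rewrite mulrDl mulrDr -bop_scaleAl ha // hb // bop_scaleAr.
Qed.

Record bic := Bic { bic_val :> bop X; bic_mem : bic_val \in bicommutant G }.

HB.instance Definition _ := [isSub for bic_val].
HB.instance Definition _ := [Choice of bic by <:].
HB.instance Definition _ := GRing.SubChoice_isSubPzRing.Build (bop X)
  (bicommutant G) bic bicommutant_subring.
HB.instance Definition _ := GRing.SubZmodule_isSubLmodule.Build R[i] (bop X)
  (bicommutant G) bic (GRing.submod_closed_semi bicommutant_submod).

Let bic_mulC : commutative (@GRing.mul bic).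
Proof.
move=> a b; apply: val_inj; rewrite !rmorphM /=.
have /asboolP ha := bic_mem a; have /asboolP hb := bic_mem b.
by apply: ha => g Gg; apply: hb => c Gc; exact: commutingP Gg Gc.
Qed.

HB.instance Definition _ := GRing.PzRing_hasCommutativeMul.Build bic bic_mulC.

Lemma bic_gen_subproof a : G a -> a \in bicommutant G.
Proof. by move=> Ga; apply/asboolP => c hc; rewrite hc. Qed.

Definition bic_gen a (Ga : G a) : bic := Bic (bic_gen_subproof Ga).

(** Scalars become ring elements through a ring morphism, so that [ring] can treat expressions
    mixing scalars and operators. *)
Definition bic_scalar (k : R[i]) : bic := k *: (1 : bic).

Lemma bic_scalar_is_zmod_morphism : zmod_morphism bic_scalar.
Proof. by move=> k l; rewrite /bic_scalar scalerBl. Qed.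

Lemma bic_scaleAl k (a b : bic) : k *: (a * b) = (k *: a) * b.
Proof. exact/val_inj/bopE. Qed.

Lemma bic_scalar_is_monoid_morphism : monoid_morphism bic_scalar.
Proof.
split=> [|k l]; first by rewrite /bic_scalar scale1r.
by rewrite /bic_scalar -bic_scaleAl mul1r scalerA.
Qed.

HB.instance Definition _ := GRing.isZmodMorphism.Build R[i] bic bic_scalar
  bic_scalar_is_zmod_morphism.
HB.instance Definition _ := GRing.isMonoidMorphism.Build R[i] bic bic_scalar
  bic_scalar_is_monoid_morphism.

Lemma bic_scalarE k (a : bic) : bic_scalar k * a = k *: a.
Proof. by rewrite -bic_scaleAl mul1r. Qed.

Lemma bic_scalarVl k : k != 0 -> bic_scalar k^-1 * bic_scalar k = 1.
Proof. by move=> k0; rewrite -rmorphM mulVf // rmorph1. Qed.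

Definition bnorm (a : bic) : R := opn a.

Lemma bnorm_ge0 a : 0 <= bnorm a. Proof. exact: opn_ge0. Qed.

Lemma bnorm0_eq0 a : bnorm a <= 0 -> a = 0.
Proof. by move=> h; apply: val_inj; exact: opn0_eq0. Qed.

Lemma bnormD a b : bnorm (a + b) <= bnorm a + bnorm b. Proof. exact: opnD. Qed.

Lemma bnormN a : bnorm (- a) = bnorm a. Proof. exact: opnN. Qed.

Lemma bnormB a b : bnorm (a - b) = bnorm (b - a).
Proof. by rewrite -bnormN opprB. Qed.

Lemma bnorm_dist a b c : bnorm (a - c) <= bnorm (a - b) + bnorm (b - c).
Proof. by rewrite (le_trans _ (bnormD _ _)) // addrA subrK. Qed.

Lemma bnormM a b : bnorm (a * b) <= bnorm a * bnorm b. Proof. exact: opnM. Qed.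

Lemma bnormZ k a : bnorm (bic_scalar k * a) <= rnorm k * bnorm a.
Proof. by rewrite bic_scalarE; exact: opnZ. Qed.

Lemma bnormX a n : bnorm (a ^+ n) <= bnorm a ^+ n.
Proof.
elim: n => [|n IH]; first by rewrite !expr0; exact: opn1.
rewrite !exprS (le_trans (bnormM _ _)) // ler_wpM2l //; exact: bnorm_ge0.
Qed.

End BicommutantAlgebra.

Section BanachAlgebra.
Context {R : realType} {X : completeNormedModType R[i]} {G : commuting X}.
Notation A := (bic G).
Notation sc := (bic_scalar G).
Implicit Types (a b g p d u t : A) (z w : R[i]).

(** The bicommutant is closed in norm: the commutator of the limit with [f] is also the commutator
    of the error with [f], hence arbitrarily small. *)
Lemma bic_geometric_cvg (u : nat -> A) (c q : R) : 0 <= q < 1 ->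
  (forall n, bnorm (u n.+1 - u n) <= c * q ^+ n) ->
  exists l : A, forall n, bnorm (u n - l) <= c / (1 - q) * q ^+ n.
Proof.
move=> hq h; have [l hl] := bop_geometric_cvg hq h.
suff lG : l \in bicommutant G by exists (Bic lG).
apply/asboolP => f hf; apply/eqP; rewrite -subr_eq0; apply/eqP/opn0_eq0.
apply: (@le0_geometric _ _ (2 * (c / (1 - q)) * opn f) q hq) => n.
have /asboolP /(_ f hf) e := bic_mem (u n).
have -> : l * f - f * l = f * (bic_val (u n) - l) - (bic_val (u n) - l) * f.
  by rewrite mulrBr mulrBl e opprB [RHS]addrC addrA subrK.
rewrite (le_trans (opnD _ _)) // opnN.
have := ler_wpM2l (opn_ge0 f) (hl n).
have := opnM f (bic_val (u n) - l); have := opnM (bic_val (u n) - l) f.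
by rewrite -[bic_val (u n) - l]/(bic_val (u n) - l); set x := opn _; lra.
Qed.

Lemma neumann a : bnorm a < 1 ->
  exists2 g, (1 - a) * g = 1 & bnorm g <= (1 - bnorm a)^-1.
Proof.
move=> a1; have hq : 0 <= bnorm a < 1 by rewrite bnorm_ge0.
pose u n : A := \sum_(k < n) a ^+ k.
have [|g hg] := @bic_geometric_cvg u 1 (bnorm a) hq.
  by move=> n; rewrite /u big_ord_recr /= [X in X - _]addrC addrK mul1r bnormX.
exists g; last first.
  by have := hg 0%N; rewrite /u big_ord0 add0r bnormN expr0 mulr1 mul1r.
apply/eqP; rewrite -subr_eq0; apply/eqP/bnorm0_eq0.
apply: (@le0_geometric _ _ (1 + bnorm (1 - a) / (1 - bnorm a)) _ hq) => n.
have au : (1 - a) * u n = 1 - a ^+ n.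
  rewrite -[in RHS](expr1n _ n) subrXX; congr (_ * _); apply: eq_bigr => i _.
  by rewrite expr1n mul1r.
have -> : (1 - a) * g - 1 = - (a ^+ n) - (1 - a) * (u n - g).
  by rewrite mulrBr au; ring.
apply: le_trans (bnormD _ _) _; rewrite !bnormN.
have h1 := bnormX a n; have h2 := bnormM (1 - a) (u n - g).
have h3 := ler_wpM2l (bnorm_ge0 (1 - a)) (hg n).
rewrite [leRHS]mulrDl [X in _ <= X + _]mul1r; apply: lerD h1 _.
by apply: le_trans h2 _; apply: le_trans h3 _; rewrite mul1r mulrA.
Qed.

Lemma regular_sub a g b : a * g = 1 -> bnorm b * bnorm g < 1 ->
  exists2 h, (a - b) * h = 1 & bnorm h <= bnorm g / (1 - bnorm b * bnorm g).
Proof.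
move=> ag bg1; have bg : bnorm (b * g) <= bnorm b * bnorm g by exact: bnormM.
have [h gh hb] := neumann (le_lt_trans bg bg1).
exists (g * h).
  by rewrite mulrA -gh; congr (_ * _); rewrite mulrBl ag.
rewrite (le_trans (bnormM _ _)) // ler_wpM2l ?bnorm_ge0 //.
rewrite (le_trans hb) // lef_pV2 ?posrE ?subr_gt0 //; last exact: le_lt_trans bg1.
by rewrite lerD2l lerN2.
Qed.

Lemma exists_small_factor (y : R) : 0 <= y -> exists2 e : R,
  0 < e & forall x : R, x < e -> 0 <= x -> x * y < 1.
Proof.
move=> y0; exists (y + 1)^-1 => [|x]; first by rewrite invr_gt0; lra.
rewrite -[_^-1]mul1r ltr_pdivlMr; last by lra.
nra.
Qed.

(* On the range of p the inverse is given by a Neumann series, on its kernel,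
   where u is nilpotent, by a finite geometric sum. *)
Lemma drazin_resolvent u m p d z g :
  p * p = p -> u ^+ m * (1 - p) = 0 -> u * d = p -> d * p = d ->
  z != 0 -> (1 - sc z * d) * g = 1 ->
  (u - sc z) * (g * d - sc z^-1 ^+ m *
    (\sum_(i < m) u ^+ (m.-1 - i) * sc z ^+ i) * (1 - p)) = 1.
Proof.
move=> pp up ud dp z0 zg.
have zz : sc z^-1 * sc z = 1 by rewrite bic_scalarVl.
set s := \sum_(i < m) _.
have us : (u - sc z) * s = u ^+ m - sc z ^+ m by rewrite subrXX.
have -> : (u - sc z) * (g * d - sc z^-1 ^+ m * s * (1 - p)) =
   g * (u * d - sc z * d) - sc z^-1 ^+ m * ((u - sc z) * s) * (1 - p).
  by ring.
rewrite us ud.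
have -> : p - sc z * d = (1 - sc z * d) * p by rewrite mulrBl mul1r -mulrA dp.
rewrite mulrA [g * _]mulrC zg mul1r.
have zm : sc z^-1 ^+ m * sc z ^+ m = 1 by rewrite -exprMn zz expr1n.
rewrite (_ : _ - _ = p - sc z^-1 ^+ m * (u ^+ m * (1 - p)) +
  sc z^-1 ^+ m * sc z ^+ m * (1 - p)); last by ring.
by rewrite up zm mulr0 subr0 mul1r addrC subrK.
Qed.

Lemma drazin_punctured_regular u : drazin u ->
  exists2 e : R, 0 < e & forall z, 0 < rnorm z < e -> regular (u - sc z).
Proof.
move=> /drazinP[m [p [d [pp up ud dp]]]].
have [e e0 he] := exists_small_factor (bnorm_ge0 d).
exists e => // z /andP[z0 ze].
have [|g zg _] := @neumann (sc z * d).
  by rewrite (le_lt_trans (bnormZ _ _)) // he // rnorm_ge0.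
eexists; apply: drazin_resolvent pp up ud dp _ zg.
by rewrite -rnorm_gt0.
Qed.

End BanachAlgebra.

(** * The complex plane *)

Section ComplexPlane.
Context {R : realType}.
Implicit Types (z w : R[i]).

(* Compactness of the disc as an induction over finite unions of balls. *)
Lemma disc_compact (P : set R[i] -> Prop) (r : R) :
  (forall A B, P A -> P B -> P (A `|` B)) ->
  (forall A B, A `<=` B -> P B -> P A) ->
  (forall z, exists2 e : R, 0 < e & P [set w | rnorm (w - z) < e]) ->
  P [set z | rnorm z <= r].
Proof.
move=> PU PS Ploc; apply: contrapT => nPD.
pose pt z : R * R := (complex.Re z, complex.Im z).
(* If [P] fails on the disc, the sets whose complement in the disc satisfies [P] form a proper
   filter. It clusters in the compact square, against the local hypothesis at the cluster point. *)
pose F : set_system (R * R)%type := [set S | P [set z | rnorm z <= r /\ ~ S (pt z)]].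
have FF : ProperFilter F.
  apply: Build_ProperFilter_ex.
    move=> S FS; apply: contrapT => S0; apply: nPD; apply: PS FS => z zr.
    by split=> // Sz; apply: S0; exists (pt z).
  split=> [|S T FS FT|S T ST].
  - have [e _] := Ploc 0; apply: PS => z [_]; case=> //.
  - apply: PS (PU _ _ FS FT) => z [zr].
    by move=> /not_andP[?|?]; [left|right].
  - by apply: PS => z [zr nT]; split=> // Sz; apply: nT; exact: ST.
have cK : compact (`[- r, r] `*` `[- r, r] : set (R * R)).
  by apply: compact_setX; exact: segment_compact.
have FK : F (`[- r, r] `*` `[- r, r]).
  have [e _] := Ploc 0; apply: PS => z [zr]; case; rewrite /= !in_itv /=.
  by rewrite -!ler_norml !(le_trans _ zr) ?Re_le_rnorm ?Im_le_rnorm.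
have [[x y] [_ clp]] := cK F FF FK.
have [e e0 Pe] := Ploc (Complex x y).
pose B : set (R * R) := [set q | rnorm (Complex q.1 q.2 - Complex x y) < e].
have FB : F (~` B) by apply: PS Pe => -[a b] [_ /contrapT].
have nB : nbhs (x, y) B.
  exists (ball x (e / 2), ball y (e / 2)) => /=.
    by split; apply: nbhsx_ballx; rewrite divr_gt0.
  move=> [a b] [/= xa yb]; rewrite /B /=.
  rewrite (le_lt_trans (rnorm_Re_Im _)) // [ltRHS]splitr /= ltrD //.
    by rewrite distrC.
  by rewrite distrC.
by have [q []] := clp _ _ FB nB.
Qed.

(** Each point has a ball in which at most the centre is exceptional, and finiteness passes to
    unions. *)
Lemma finite_exceptional (Q : set R[i]) (r : R) :
  (forall z, exists2 e : R, 0 < e & forall w, 0 < rnorm (w - z) < e -> Q w) ->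
  finite_set [set z | rnorm z <= r /\ ~ Q z].
Proof.
move=> Qloc; pose P (A : set R[i]) := finite_set (A `&` ~` Q).
have := @disc_compact P r; apply => [A B fA fB|A B AB|z].
- by rewrite /P setIUl finite_setU.
- by apply: sub_finite_set => z [Az nQ]; split=> //; exact: AB.
have [e e0 he] := Qloc z; exists e => //.
apply: (@sub_finite_set _ _ [set z]); last exact: finite_set1.
move=> w [/= we nQ]; apply: contrapT => wz; apply: nQ; apply: he.
by rewrite we andbT rnorm_gt0 subr_eq0; apply/eqP.
Qed.

(** Connectedness is used only along the segment from [z0] to [z]: closedness puts the supremum of
    the good parameters in [W], openness pushes it to 1. *)
Lemma clopen_plane (W : set R[i]) z0 :
  (forall z, W z -> exists2 e : R, 0 < e & forall w, rnorm (w - z) < e -> W w) ->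
  (forall z, (forall e : R, 0 < e -> exists2 w, rnorm (w - z) < e & W w) -> W z) ->
  W z0 -> forall z, W z.
Proof.
move=> Wo Wc W0 z.
pose g (t : R) := z0 + (t%:C%C) * (z - z0).
have gB (s t : R) : rnorm (g s - g t) = `|s - t| * rnorm (z - z0).
  by rewrite /g opprD addrACA subrr add0r -mulrBl -rmorphB rnormM rnorm_real.
pose S : set R := [set t | 0 <= t <= 1 /\ W (g t)].
have S0 : S 0 by rewrite /S /= lexx ler01 /g rmorph0 mul0r addr0.
have S1 : ubound S 1 by move=> t [/andP[]].
have hS : has_sup S by split; [exists 0|exists 1].
have L0 : 0 < rnorm (z - z0) + 1 by rewrite ltr_wpDl // rnorm_ge0.
have [s0 s1] : 0 <= sup S /\ sup S <= 1.
  by split; [apply: ub_le_sup => //; exists 1|apply: ge_sup => //; exists 0].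
have Ws : W (g (sup S)).
  apply: Wc => e e0; have e1 : 0 < e / (rnorm (z - z0) + 1) by rewrite divr_gt0.
  have [t St ts] := sup_adherent e1 hS.
  exists (g t); last by case: St.
  have tS : t <= sup S by apply: ub_le_sup => //; exists 1.
  rewrite gB ler0_norm ?subr_le0 // opprB.
  have : (sup S - t) * (rnorm (z - z0) + 1) < e by rewrite -ltr_pdivlMr //; lra.
  by apply: le_lt_trans; rewrite mulrDr lerDl mulr1 subr_ge0.
have [e e0 he] := Wo _ Ws.
have [s1'|s1'] := ltP (sup S) 1; last first.
  have -> : z = g (sup S); last by [].
  have -> : sup S = 1 by apply/eqP; rewrite eq_le s1.
  by rewrite /g rmorph1 mul1r addrC subrK.
(* A step that stays in the segment and moves [g] by less than [e]; adding 1 to the denominator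
   covers [z = z0]. *)
pose d := Num.min (1 - sup S) (e / (rnorm (z - z0) + 1) / 2).
have d0 : 0 < d by rewrite lt_min subr_gt0 s1' !divr_gt0.
suff /(ub_le_sup _) : S (sup S + d) by move=> /(_ (ex_intro _ 1 S1)); lra.
have d1 : d <= 1 - sup S by rewrite ge_min lexx.
split; first by apply/andP; split; lra.
apply: he; rewrite gB addrAC subrr add0r gtr0_norm //.
have : d <= e / (rnorm (z - z0) + 1) / 2 by rewrite ge_min lexx orbT.
rewrite ler_pdivlMr // ler_pdivlMr //; move: L0 d0 e0 (rnorm_ge0 (z - z0)).
by clear; nra.
Qed.

End ComplexPlane.

(** * Riesz projections *)

Section RieszProjection.
Context {R : realType} {X : completeNormedModType R[i]} {G : commuting X}.
Notation A := (bic G).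
Notation sc := (bic_scalar G).
Implicit Types (a b p d u t : A) (z w : R[i]).

Lemma inverse_unique a g h : a * g = 1 -> a * h = 1 -> g = h.
Proof. by move=> ag ah; rewrite -[g]mulr1 -ah mulrA [g * a]mulrC ag mul1r. Qed.

(** Inverses are locally bounded by the Neumann series. [P] only constrains points on the circle, so
    compactness of the disc suffices: points off the circle have neighbourhoods where nothing is
    asked. *)
Lemma circle_bound a : (forall z, rnorm z = 1 -> regular (1 - sc z * a)) ->
  exists K : R, forall z, rnorm z = 1 ->
    exists2 g, (1 - sc z * a) * g = 1 & bnorm g <= K.
Proof.
move=> reg.
pose P (S : set R[i]) := exists K : R, forall z, S z -> rnorm z = 1 ->
  exists2 g, (1 - sc z * a) * g = 1 & bnorm g <= K.
suff [K hK] : P [set z | rnorm z <= 1] by exists K => z z1; apply: hK => //=; rewrite z1.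
apply: disc_compact => [A B [K hK] [L hL]|A B AB [K hK]|z].
- exists (Num.max K L) => z [Az|Bz] z1.
    by have [g gz gK] := hK z Az z1; exists g => //; rewrite le_max gK.
  by have [g gz gK] := hL z Bz z1; exists g => //; rewrite le_max gK orbT.
- by exists K => z /AB; exact: hK.
have triv (e : R) : 0 < e -> (forall w, rnorm (w - z) < e -> rnorm w != 1) ->
    exists2 e : R, 0 < e & P [set w | rnorm (w - z) < e].
  by move=> e0 he; exists e => //; exists 0 => w /he /eqP.
have tri w : `|rnorm w - rnorm z| <= rnorm (w - z).
  rewrite ler_norml; have := rnormD_le (w - z) z; have := rnormD_le (z - w) w.
  by rewrite !subrK [rnorm (z - w)]rnormB => ? ?; apply/andP; split; lra.
have [z1|z1|z1] := ltgtP (rnorm z) 1.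
- apply: (triv (1 - rnorm z)) => [|w wz]; first by rewrite subr_gt0.
  have := tri w; rewrite ler_norml => /andP[_ h].
  by apply/eqP; lra.
- apply: (triv (rnorm z - 1)) => [|w wz]; first by rewrite subr_gt0.
  have := tri w; rewrite ler_norml => /andP[h _].
  by apply/eqP; lra.
have [g gz] := reg z z1.
(* The factor 2 makes the perturbation at most half of what the Neumann series allows, whence the
   bound [2 * bnorm g]. *)
have [e e0 he] := exists_small_factor (mulr_ge0 (ler0n R 2) (mulr_ge0 (bnorm_ge0 a) (bnorm_ge0 g))).
exists e => //; exists (2 * bnorm g) => w /= we w1.
have be : bnorm (sc (w - z) * a) * bnorm g < 2^-1.
  have := he _ we (rnorm_ge0 _); have := bnormZ (w - z) a.
  move=> /(ler_wpM2r (bnorm_ge0 g)); lra.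
have [|h hw hb] := regular_sub gz (b := sc (w - z) * a).
  by apply: lt_trans be _; lra.
exists h; first by rewrite -[RHS]hw; congr (_ * _); rewrite rmorphB /=; ring.
rewrite (le_trans hb) // ler_pdivrMr; last by lra.
by have := bnorm_ge0 g; nra.
Qed.

(** The Lipschitz constant [L] is recorded because it is the quantity that shrinks when [a] is
    squared. *)
Definition circle_inverse a (L : R) (g : R[i] -> A) :=
  (forall z, rnorm z = 1 -> (1 - sc z * a) * g z = 1) /\
  (forall z w, rnorm z = 1 -> rnorm w = 1 ->
     bnorm (g z - g w) <= L * rnorm (z - w)).

(** By the resolvent identity, a uniform bound [K] gives the Lipschitz constant
    [bnorm a * (K * K)]. *)
Lemma circle_inverse_exists a :
  (forall z, rnorm z = 1 -> regular (1 - sc z * a)) ->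
  exists2 L : R, 0 <= L & exists g, circle_inverse a L g.
Proof.
move=> /circle_bound[K hK].
have /choice[g hg] z : exists b : A, rnorm z = 1 ->
    (1 - sc z * a) * b = 1 /\ bnorm b <= K.
  have [z1|z1] := pselect (rnorm z = 1); last by exists 0.
  by have [g gz gK] := hK z z1; exists g.
have K0 : 0 <= K by have [_] := hg 1 rnorm1; apply: le_trans; exact: bnorm_ge0.
exists (bnorm a * (K * K)); first by rewrite !mulr_ge0 ?bnorm_ge0.
exists g; split=> [z z1|z w z1 w1]; first by have [] := hg z z1.
have [gz gzK] := hg z z1; have [gw gwK] := hg w w1.
have -> : g z - g w = sc (z - w) * (a * (g z * g w)).
  have -> : g z - g w = g z * ((1 - sc w * a) * g w) - g w * ((1 - sc z * a) * g z).
    by rewrite gz gw !mulr1.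
  by rewrite rmorphB /=; ring.
rewrite (le_trans (bnormZ _ _)) // mulrC ler_wpM2r ?rnorm_ge0 //.
rewrite (le_trans (bnormM _ _)) // ler_wpM2l ?bnorm_ge0 //.
by rewrite (le_trans (bnormM _ _)) // ler_pM ?bnorm_ge0.
Qed.

(* Averaging (1 - s a)^-1 over the two square roots s of z gives (1 - z a^2)^-1.
   The square root is locally (1/sqrt 2)-Lipschitz on the circle for a suitable
   choice of signs, and 1/sqrt 2 < 3/4. *)
Lemma circle_inverse_sqr a (L : R) g : 0 <= L -> circle_inverse a L g ->
  exists g', circle_inverse (a ^+ 2) (L * (3 / 4)) g'.
Proof.
move=> L0 [ga gL].
have sqrt_circle z : rnorm z = 1 -> rnorm (sqrtC z) = 1.
  move=> z1; apply/eqP; rewrite -(@eqrXn2 _ 2) ?rnorm_ge0 //.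
  by rewrite -rnormX sqrtCK expr1n z1.
have half : sc 2^-1 + sc 2^-1 = 1.
  rewrite -rmorphD /= -(rmorph1 sc); congr (sc _).
  by rewrite [RHS]splitr mul1r.
pose f s : A := sc 2^-1 * (g s + g (- s)).
have fN s : f (- s) = f s by rewrite /f opprK addrC.
have fL s s' : rnorm s = 1 -> rnorm s' = 1 -> bnorm (f s - f s') <= L * rnorm (s - s').
  move=> s1 s1'.
  have -> : f s - f s' = sc 2^-1 * ((g s - g s') + (g (- s) - g (- s'))).
    by rewrite /f; ring.
  rewrite (le_trans (bnormZ _ _)) // rnormV.
  rewrite rnorm2.
  have := bnormD (g s - g s') (g (- s) - g (- s')).
  have := gL s s' s1 s1'; have := gL (- s) (- s').
  rewrite -opprD !rnormN => /(_ s1 s1').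
  lra.
exists (fun z => f (sqrtC z)); split=> [z z1|z w z1 w1].
  set s := sqrtC z; have s1 : rnorm s = 1 by exact: sqrt_circle.
  have -> : z = s * s by rewrite -expr2 sqrtCK.
  have h1 := ga s s1; have := ga (- s); rewrite rnormN => /(_ s1) h2.
  rewrite rmorphM /f.
  have -> : (1 - sc s * sc s * a ^+ 2) * (sc 2^-1 * (g s + g (- s))) =
     sc 2^-1 * ((1 - sc (- s) * a) * ((1 - sc s * a) * g s) +
                (1 - sc s * a) * ((1 - sc (- s) * a) * g (- s))).
    by rewrite rmorphN /=; ring.
  by rewrite h1 h2 rmorphN /= -[RHS]half; ring.
(* Here |s - s'| = |s^2 - s'^2| / |s + s'|, at most 3/4 of |s^2 - s'^2|. *)
have main s s' : rnorm s = 1 -> rnorm s' = 1 -> 4 / 3 <= rnorm (s + s') ->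
    bnorm (f s - f s') <= L * (3 / 4) * rnorm (s ^+ 2 - s' ^+ 2).
  move=> s1 s1' h; rewrite (le_trans (fL _ _ s1 s1')) //.
  rewrite subr_sqr rnormM -mulrA ler_wpM2l //.
  by have := rnorm_ge0 (s - s'); nra.
have [s1 s1'] := (sqrt_circle z z1, sqrt_circle w w1).
rewrite -{2}[z]sqrtCK -{2}[w]sqrtCK.
(* The squares of |s + s'| and |s - s'| add up to 4, so one of the two moduli is at least 4/3; as
   [f] is even, the sign of s' is free. *)
have := rnorm_parallelogram (sqrtC z) (sqrtC w); rewrite s1 s1' => par.
have [h|h] := leP (4 / 3) (rnorm (sqrtC z + sqrtC w)); first exact: main.
rewrite -(fN (sqrtC w)) -[sqrtC w ^+ 2]sqrrN; apply: main; rewrite ?rnormN //.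
have := rnorm_ge0 (sqrtC z + sqrtC w); have := rnorm_ge0 (sqrtC z - sqrtC w).
nra.
Qed.

Lemma circle_inverse_iter a (L : R) g k : 0 <= L -> circle_inverse a L g ->
  exists g', circle_inverse (a ^+ (2 ^ k)) (L * (3 / 4) ^+ k) g'.
Proof.
move=> L0 ag; elim: k => [|k [g' IH]]; first by exists g; rewrite expr1 expr0 mulr1.
rewrite expnSr exprM (exprSr (3 / 4)) (mulrA L); apply: circle_inverse_sqr _ IH.
by rewrite mulr_ge0 // exprn_ge0.
Qed.

(** With b = a^(2^k), u = (1 - b)^-1 and v = (1 + b)^-1, the next u is both u v and (u + v) / 2.
    Since u - v tends to 0 by the Lipschitz bound between 1 and -1, u and v have the same limit p,
    and p = p^2. *)
Lemma riesz_limit a : (forall z, rnorm z = 1 -> regular (1 - sc z * a)) ->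
  exists p (C : R), p * p = p /\ forall k, exists2 g,
    (1 - a ^+ (2 ^ k)) * g = 1 & bnorm (g - p) <= C * (3 / 4) ^+ k.
Proof.
move=> /circle_inverse_exists[L L0 [g0 hg0]].
have [g hg] := choice (fun k => circle_inverse_iter k L0 hg0).
pose u k := g k 1; pose v k := g k (- 1).
have N1 : rnorm (-1 : R[i]) = 1 by rewrite rnormN rnorm1.
have ug k : (1 - a ^+ (2 ^ k)) * u k = 1.
  by have [/(_ 1 rnorm1)] := hg k; rewrite rmorph1 mul1r.
have vg k : (1 + a ^+ (2 ^ k)) * v k = 1.
  by have [/(_ _ N1)] := hg k; rewrite rmorphN rmorph1 mulN1r opprK.
have uv k : bnorm (u k - v k) <= 2 * (L * (3 / 4) ^+ k).
  have [_ /(_ _ _ rnorm1 N1)] := hg k; rewrite opprK mulrC.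
  by rewrite -[1 + 1]/(2 : R[i]) rnorm2.
have half : sc 2^-1 + sc 2^-1 = 1.
  rewrite -rmorphD /= -(rmorph1 sc); congr (sc _).
  by rewrite [RHS]splitr mul1r.
have uM k : u k.+1 = u k * v k.
  apply: inverse_unique (ug k.+1) _; rewrite expnSr exprM.
  set b := a ^+ _.
  rewrite (_ : _ * _ = ((1 - b) * u k) * ((1 + b) * v k)); last by ring.
  by rewrite ug vg mulr1.
have uD k : u k.+1 = sc 2^-1 * (u k + v k).
  apply: inverse_unique (ug k.+1) _; rewrite expnSr exprM.
  set b := a ^+ _.
  rewrite (_ : _ * _ = sc 2^-1 * ((1 + b) * ((1 - b) * u k) + (1 - b) * ((1 + b) * v k)));
    last by ring.
  by rewrite ug vg -[RHS]half; ring.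
have hq : 0 <= (3 / 4 : R) < 1 by apply/andP; split; lra.
have [|p hp] := @bic_geometric_cvg _ _ _ u L (3 / 4) hq.
  move=> n; have -> : u n.+1 - u n = sc 2^-1 * (v n - u n).
    by rewrite uD -[X in _ - X]mul1r -half; ring.
  rewrite (le_trans (bnormZ _ _)) // rnormV bnormB.
  rewrite rnorm2.
  by have := uv n; lra.
have up k : bnorm (u k - p) <= 4 * L * (3 / 4) ^+ k.
  by have := hp k; rewrite (_ : L / _ = 4 * L) //; field.
exists p, (4 * L); split; last by move=> k; exists (u k).
apply/eqP; rewrite -subr_eq0 -oppr_eq0 opprB; apply/eqP/bnorm0_eq0.
apply: (@le0_geometric _ _
  (4 * L + 4 * L * (bnorm p + 6 * L) + bnorm p * (6 * L)) _ hq) => k.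
set q := (3 / 4) ^+ k; have q0 : 0 <= q by rewrite exprn_ge0.
have q1 : q <= 1 by rewrite exprn_ile1 //; lra.
(* The constant is 2 L from [uv] plus 4 L from [up]. *)
have vp : bnorm (v k - p) <= 6 * L * q.
  apply: le_trans (bnorm_dist _ (u k) _) _; rewrite [bnorm (v k - u k)]bnormB.
  by apply: le_trans (lerD (uv k) (up k)) _; rewrite -/q; lra.
have pu : bnorm (p - u k.+1) <= 4 * L * q.
  rewrite bnormB; apply: le_trans (up k.+1) _; rewrite exprS -/q.
  by rewrite ler_wpM2l ?mulr_ge0 // ler_piMl //; clear vp; lra.
have -> : p - p * p = (p - u k.+1) + ((u k - p) * v k + p * (v k - p)).
  by rewrite uM; ring.
have vb : bnorm (v k) <= bnorm p + 6 * L.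
  have := bnormD p (v k - p); rewrite [p + _]addrC subrK.
  have : 6 * L * q <= 6 * L by nra.
  lra.
have := ler_pM (bnorm_ge0 _) (bnorm_ge0 _) (up k) vb.
have := ler_wpM2l (bnorm_ge0 p) vp.
have := bnormM (u k - p) (v k); have := bnormM p (v k - p).
have := bnormD ((u k - p) * v k) (p * (v k - p)).
have := bnormD (p - u k.+1) ((u k - p) * v k + p * (v k - p)).
move: pu; rewrite -/q; do !move: (bnorm _) => ?.
clear vp vb; lra.
Qed.

(** Let g = (1 - a^n)^-1 be close to p. From a^n g = g - 1, a^n g is close to -1 on the range of 1 -
    p, so a is invertible there; on the range of p the power a^n is small, which keeps the spectrum
    of t p inside the disc. *)
Lemma riesz_projection t (r : R) : 0 < r ->
  (forall z, rnorm z = r -> regular (t - sc z)) ->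
  exists p s, [/\ p * p = p, t * s = 1 - p &
    forall z, r <= rnorm z -> regular (t * p - sc z)].
Proof.
move=> r0 reg; pose c : R[i] := r%:C%C.
have c0 : c != 0 by rewrite -rnorm_gt0 rnorm_real gtr0_norm.
have scc : sc c * sc c^-1 = 1 by rewrite mulrC bic_scalarVl.
pose a := sc c^-1 * t.
have ta : t = sc c * a by rewrite /a mulrA scc mul1r.
have [z z1|p [C [pp hp]]] := @riesz_limit a.
  have z0 : z != 0 by rewrite -rnorm_gt0 z1.
  have scz := bic_scalarVl G z0.
  have [|g hg] := reg (c * z^-1).
    by rewrite rnormM rnormV z1 invr1 mulr1 rnorm_real gtr0_norm.
  exists (- (g * sc c * sc z^-1)).
  have -> : (1 - sc z * a) * - (g * sc c * sc z^-1) =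
     (sc z^-1 * sc z) * (sc c * sc c^-1) * (t * g) - sc c * sc z^-1 * g.
    by rewrite /a; ring.
  by rewrite scz scc !mul1r -rmorphM -mulrBl.
(* The bound 1/2 is used for [a ^+ n * p]: its norm is at most x / (1 - x) with x the norm of
   [p * (p - g)], and this is below 1 when x < 1/2. *)
have h1 : 0 < (2^-1 : R) by lra.
have h2 : (2^-1 : R) < 1 by lra.
have pN : (1 - p) * p = 0 by rewrite mulrBl pp mul1r subrr.
have hq : 0 <= (3 / 4 : R) < 1 by apply/andP; split; lra.
have [N hN] := @geometric_small _ ((bnorm (1 - p) + bnorm p) * C) _ _ hq h1.
have [g ga gp] := hp N; have {hN} := hN N (leqnn _).
set n := (2 ^ N)%N in ga *; have n0 : (0 < n)%N by rewrite expn_gt0.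
move=> hN.
have gp' : (bnorm (1 - p) + bnorm p) * bnorm (g - p) < 2^-1.
  apply: le_lt_trans hN; rewrite -mulrA ler_wpM2l //.
  by rewrite addr_ge0 ?bnorm_ge0.
have b1 : bnorm ((1 - p) * (g - p)) < 1.
  apply: le_lt_trans (bnormM _ _) _.
  move: {hN} gp' (bnorm_ge0 (1 - p)) (bnorm_ge0 p) (bnorm_ge0 (g - p)).
  by do !move: (bnorm _) => ?; nra.
have b2 : bnorm (p * (p - g)) < 2^-1.
  apply: le_lt_trans (bnormM _ _) _; rewrite bnormB.
  move: {hN b1} gp' (bnorm_ge0 (1 - p)) (bnorm_ge0 p) (bnorm_ge0 (g - p)).
  by do !move: (bnorm _) => ?; nra.
have [h hh _] := neumann b1.
have [h' hh' hb'] := neumann (lt_trans b2 h2).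
exists p, (- (sc c^-1 * a ^+ n.-1 * g * (1 - p) * h)); split=> //.
  have -> : t * - (sc c^-1 * a ^+ n.-1 * g * (1 - p) * h) =
      - ((a * a ^+ n.-1) * g * (1 - p) * h) by rewrite /a; ring.
  rewrite -exprS prednK //.
  have -> : a ^+ n * g = g - 1 by rewrite -ga; ring.
  have -> : - ((g - 1) * (1 - p) * h) = (1 - p) * ((1 - (1 - p) * (g - p)) * h)
     + (p * p - p) * ((g - p) * h) - p * (1 - p) * h by ring.
  by rewrite hh pp subrr mul0r addr0 mulr1 [p * _]mulrC pN mul0r subr0.
have anp : a ^+ n * p = - (p * (p - g) * h').
  have pe : p * (1 - p * (p - g)) = p * g.
    by rewrite mulrBr mulr1 mulrA pp mulrBr pp; ring.
  have ag : a ^+ n * g = g - 1 by rewrite -ga; ring.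
  rewrite -[LHS]mulr1 -hh'.
  rewrite (_ : _ * _ = p * (1 - p * (p - g)) * (a ^+ n * h')); last by ring.
  rewrite pe (_ : _ * _ = p * (a ^+ n * g) * h'); last by ring.
  by rewrite ag mulrBr mulr1 mulrBr pp; ring.
have bn : bnorm (a ^+ n * p) < 1.
  rewrite anp bnormN; apply: le_lt_trans (bnormM _ _) _.
  move: hb'; rewrite -[_^-1]mul1r ler_pdivlMr; last by rewrite subr_gt0 (lt_trans b2).
  move: {hN b1 gp'} b2 (bnorm_ge0 (p * (p - g))) (bnorm_ge0 h').
  by do !move: (bnorm _) => ?; nra.
move=> z rz; have z0 : z != 0 by rewrite -rnorm_gt0; apply: lt_le_trans rz.
have scz : sc z * sc z^-1 = 1 by rewrite mulrC bic_scalarVl.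
have ppn : p ^+ n = p.
  by rewrite -(prednK n0); elim: n.-1 => [|k IH]; rewrite ?expr1 // exprS IH pp.
pose e := sc (c * z^-1) ^+ n * (a ^+ n * p).
have [|f ef _] := @neumann _ _ _ e.
  apply: le_lt_trans bn; rewrite /e -rmorphXn (le_trans (bnormZ _ _)) //.
  rewrite ler_piMl ?bnorm_ge0 // rnormX exprn_ile1 ?rnorm_ge0 //.
  rewrite rnormM rnormV rnorm_real gtr0_norm // ler_pdivrMr ?mul1r //.
  exact: lt_le_trans rz.
(* Only the [n]-th power is known to be small, so t p - z is inverted as a factor of (t p)^n -
   z^n. *)
pose s := \sum_(i < n) (t * p) ^+ (n.-1 - i) * sc z ^+ i.
have us : (t * p - sc z) * s = (t * p) ^+ n - sc z ^+ n by rewrite subrXX.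
exists (- (s * f * sc z^-1 ^+ n)).
have zz : sc z ^+ n * sc z^-1 ^+ n = 1 by rewrite -exprMn scz expr1n.
have E : e = sc c ^+ n * sc z^-1 ^+ n * (a ^+ n * p).
  by rewrite /e rmorphM exprMn.
have T : (t * p) ^+ n = sc c ^+ n * (a ^+ n * p).
  by rewrite exprMn ppn {1}ta exprMn mulrA.
rewrite (_ : _ * _ = - ((t * p - sc z) * s) * f * sc z^-1 ^+ n); last by ring.
rewrite us T (_ : _ * _ * _ = sc z ^+ n * sc z^-1 ^+ n * f -
  sc c ^+ n * sc z^-1 ^+ n * (a ^+ n * p) * f); last by ring.
by rewrite zz mul1r -E -[in X in X - _](mul1r f) -mulrBl.
Qed.

End RieszProjection.

(** * Poles of the resolvent *)

Section OperatorDrazin.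
Context {R : realType} {X : normedModType R[i]}.

Definition op_drazin (U : X -> X) := exists m B,
  [/\ bounded_operator B, forall x, U (B x) = B (U x) &
      forall x, iter m U x = iter m.+1 U (B x)].

Lemma op_drazinP (u : bop X) :
  op_drazin u <-> exists m b, u * b = b * u /\ u ^+ m = u ^+ m.+1 * b.
Proof.
split=> [[m [B [hB uB hm]]]|[m [b [ub hm]]]].
  exists m, (Bop hB); split; apply: bopE => x; first exact: uB.
  by rewrite bop_mulE !bop_expE hm.
exists m, b; split; first exact: bopP.
  by move=> x; rewrite -!bop_mulE ub.
by move=> x; rewrite -!bop_expE hm bop_mulE.
Qed.

(** A quasi-inverse found in L(X) need not lie in the bicommutant; [drazin_bicommutant] supplies one
    that does. *)
Lemma bic_drazinP (G : commuting X) (u : bic G) : op_drazin u <-> drazin u.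
Proof.
rewrite op_drazinP; split=> [[m [b [ub hm]]]|[m [b hm]]]; last first.
  exists m, (bic_val b); split; first by have := congr1 val (mulrC u b); rewrite !rmorphM.
  by have := congr1 val hm; rewrite rmorphM !rmorphXn.
have [d hd dc] := drazin_bicommutant ub hm.
have dG : d \in bicommutant G.
  apply/asboolP => c hc; apply: dc.
  by have /asboolP := bic_mem u; move=> /(_ c hc) ->.
exists m, (Bic dG); apply: val_inj.
by rewrite rmorphM !rmorphXn.
Qed.

Lemma regularP (G : commuting X) (u : bic G) :
  regular u <-> exists S, bounded_inverse u S.
Proof.
split=> [[v uv]|[S [hS Sl Sr]]].
  exists v; split; first exact: bopP.
    move=> x; have /(congr1 val) := uv; rewrite mulrC rmorphM /= => h.
    by rewrite -[LHS]/((bic_val v * bic_val u) x) h.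
  move=> x; have /(congr1 val) := uv; rewrite rmorphM /= => h.
  by rewrite -[LHS]/((bic_val u * bic_val v) x) h.
have SG : Bop hS \in bicommutant G.
  apply/asboolP => c hc; have /asboolP /(_ c hc) uc := bic_mem u.
  apply: bopE => x; rewrite !bop_mulE /=.
  rewrite -{1}[x]Sr -[c (u _)]/((c * bic_val u) (S x)) -uc.
  exact: Sl.
by exists (Bic SG); apply/val_inj/bopE => x; exact: Sr.
Qed.

Lemma commuting1_subproof (a : bop X) b c : b = a -> c = a -> b * c = c * b.
Proof. by move=> -> ->. Qed.

Definition commuting1 (a : bop X) : commuting X :=
  Commuting (@commuting1_subproof a).

Lemma commuting2_subproof (a b : bop X) (ab : a * b = b * a) c d :
  c = a \/ c = b -> d = a \/ d = b -> c * d = d * c.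
Proof. by move=> [->|->] [->|->]. Qed.

Definition commuting2 (a b : bop X) (ab : a * b = b * a) : commuting X :=
  Commuting (commuting2_subproof ab).

Definition bic1 (a : bop X) : bic (commuting1 a) :=
  @bic_gen _ _ (commuting1 a) a erefl.

Lemma op_drazin_inverse (U S : X -> X) : bounded_inverse U S -> op_drazin U.
Proof.
move=> [hS Sl Sr]; by exists 0%N, S; split=> // x; rewrite ?Sl Sr.
Qed.

(** If all earlier coefficients vanish, the term of index [k] at z = t rho is controlled by the
    tail, which is of order t^(k+1); dividing by t^k and letting t tend to 0 kills [c k]. *)
Lemma bop_power_series_eq0 (c : nat -> bop X) (r : R) : 0 < r ->
  (forall z : R[i], 0 < rnorm z < r -> forall e : R, 0 < e ->
     exists N, forall n, (N <= n)%N -> opn (\sum_(k < n) z ^+ k *: c k) <= e) ->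
  forall k, c k = 0.
Proof.
move=> r0 hc.
pose s (z : R[i]) n := \sum_(k < n) z ^+ k *: c k.
pose rho : R := r / 2; have rho0 : 0 < rho by rewrite divr_gt0.
have rnC (x : R) : 0 < x -> rnorm (x%:C%C) = x by move=> x0; rewrite rnorm_real gtr0_norm.
have opnZ_eq (x : R) n (b : bop X) : 0 < x ->
    opn ((x%:C%C) ^+ n *: b) <= x ^+ n * opn b.
  by move=> x0; rewrite (le_trans (opnZ _ _)) // rnormX rnC.
have opn_term (x : R) n (b : bop X) : 0 < x ->
    x ^+ n * opn b <= opn ((x%:C%C) ^+ n *: b).
  move=> x0; rewrite mulrC -ler_pdivlMr ?exprn_gt0 //.
  have xn0 : (x%:C%C : R[i]) ^+ n != 0.
    by rewrite expf_neq0 // -rnorm_gt0 rnC.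
  rewrite -{1}[b]scale1r -(mulVf xn0) -scalerA (le_trans (opnZ _ _)) //.
  by rewrite rnormV rnormX rnC // mulrC.
(* At [rho] the late terms are differences of partial sums of norm at most 1, whence the 2; the
   finitely many early ones are added. *)
have [K hK] : exists K : R, forall n, rho ^+ n * opn (c n) <= K.
  have [|N hN] := hc (rho%:C%C) _ 1 ltr01.
    by rewrite rnC // rho0 /rho; lra.
  exists (2 + \sum_(k < N) rho ^+ k * opn (c k)) => n.
  have S0 : 0 <= \sum_(k < N) rho ^+ k * opn (c k).
    by apply: sumr_ge0 => i _; rewrite mulr_ge0 ?opn_ge0 ?exprn_ge0 // ltW.
  have [nN|Nn] := ltnP n N.
    rewrite (bigD1 (Ordinal nN)) //=.
    rewrite -[leLHS]addr0 addrCA lerD2l addr_ge0 //.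
    by apply: sumr_ge0 => i _; rewrite mulr_ge0 ?opn_ge0 ?exprn_ge0 // ltW.
  rewrite (le_trans (opn_term _ _ _ rho0)) //.
  have -> : (rho%:C%C : R[i]) ^+ n *: c n = s (rho%:C%C) n.+1 - s (rho%:C%C) n.
    by rewrite /s big_ord_recr /= [X in X - _]addrC addrK.
  have := opnD (s (rho%:C%C) n.+1) (- s (rho%:C%C) n); rewrite opnN.
  have := hN n Nn; have := hN n.+1 (leqW Nn); rewrite -!/(s _ _); lra.
elim/ltn_ind => k IH; apply: opn0_eq0.
have K0 : 0 <= K.
  by apply: le_trans (hK 0%N); rewrite expr0 mul1r opn_ge0.
(* For a non-zero [c k], the choice of [y] makes the right-hand side at most half of the left-hand
   side. *)
suff main (t : R) : 0 < t -> t <= 1 / 2 -> rho ^+ k * opn (c k) <= (2 * K + 1) * t.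
  rewrite leNgt; apply/negP => ck0.
  have x0 : 0 < rho ^+ k * opn (c k) by rewrite mulr_gt0 ?exprn_gt0.
  pose y := rho ^+ k * opn (c k) / (2 * (2 * K + 1)).
  have y0 : 0 < y by rewrite divr_gt0 //; lra.
  have m0 : 0 < Num.min y (1 / 2) by rewrite lt_min y0 divr_gt0.
  have := main _ m0; rewrite ge_min lexx orbT => /(_ isT).
  have : Num.min y (1 / 2) <= y by rewrite ge_min lexx.
  have -> : rho ^+ k * opn (c k) = y * (2 * (2 * K + 1)).
    by rewrite /y mulfVK //; apply/eqP; lra.
  by nra.
move=> t0 t12; set z : R[i] := ((t * rho)%:C%C).
have tr0 : 0 < t * rho by rewrite mulr_gt0.
have hr : rho * 2 = r by rewrite /rho divfK // pnatr_eq0.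
have zr : 0 < rnorm z < r by rewrite rnC // tr0 /=; nra.
have tk0 : 0 < t ^+ k.+1 by rewrite exprn_gt0.
have tail n : opn (s z (k.+1 + n)%N - z ^+ k *: c k) <=
    K * t ^+ k.+1 * (2 * (1 - 2^-1 ^+ n)).
  elim: n => [|n IHn].
    rewrite addn0 /s big_ord_recr /= big1 ?add0r ?subrr ?opn0 ?expr0 ?subrr ?mulr0 //.
    by move=> i _; rewrite IH ?scaler0.
  have -> : s z (k.+1 + n.+1)%N - z ^+ k *: c k =
      (s z (k.+1 + n)%N - z ^+ k *: c k) + z ^+ (k.+1 + n) *: c (k.+1 + n)%N.
    by rewrite addnS /s big_ord_recr /= addrAC.
  rewrite (le_trans (opnD _ _)) //.
  have h1 : opn (z ^+ (k.+1 + n) *: c (k.+1 + n)%N) <= K * t ^+ k.+1 * 2^-1 ^+ n.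
    rewrite (le_trans (opnZ_eq _ _ _ tr0)) // exprMn -[leLHS]mulrA.
    have tn0 : 0 <= t ^+ (k.+1 + n) by rewrite exprn_ge0 // ltW.
    apply: le_trans (ler_wpM2l tn0 (hK (k.+1 + n)%N)) _.
    rewrite (exprD t) mulrC mulrA ler_wpM2l ?(mulr_ge0 K0 (ltW tk0)) //.
    by apply: lerXn2r; rewrite ?nnegrE //; lra.
  rewrite (le_trans (lerD IHn h1)) //.
  rewrite le_eqVlt; apply/orP; left; apply/eqP; rewrite (exprS 2^-1).
  by set x := 2^-1 ^+ n; set y := K * _; field.
(* The tolerance t^(k+1) has the order of the tail, so it contributes only the 1 in [2 * K + 1]. *)
have [N hN] := hc z zr _ tk0.
have := tail N; have := hN (k.+1 + N)%N (leq_addl _ _); rewrite -/(s _ _).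
have p0 : 0 <= (2^-1 : R) ^+ N by rewrite exprn_ge0.
have := opnD (s z (k.+1 + N)%N) (- (s z (k.+1 + N)%N - z ^+ k *: c k)).
rewrite opnN opprB addrC subrK => h1 h2 h3.
have := opn_term _ k (c k) tr0; rewrite -/z exprMn -mulrA => h4.
have Kt : 0 <= K * t ^+ k.+1 by rewrite mulr_ge0 // ltW.
have h5 : t ^+ k * (rho ^+ k * opn (c k)) <= t ^+ k * ((2 * K + 1) * t).
  have -> : t ^+ k * ((2 * K + 1) * t) = (2 * K + 1) * t ^+ k.+1.
    by rewrite exprS; ring.
  nra.
by move: h5; rewrite ler_pM2l // exprn_gt0.
Qed.

End OperatorDrazin.

Section Poles.
Context {R : realType}.

Lemma bop_sumE (X : normedModType R[i]) n (f : 'I_n -> bop X) x :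
  (\sum_i f i) x = \sum_i f i x.
Proof. by elim/big_ind2: _ => [//|a u b v <- <-|//]. Qed.

Lemma shift_opD (X : normedModType R[i]) (t : bop X) (lambda z : R[i]) x :
  shift_op t (lambda + z) x = (t - lambda *: (1 : bop X) - z *: (1 : bop X)) x.
Proof. by rewrite /shift_op scalerDl opprD addrA. Qed.

(** Comparing coefficients in (u - z) (sum of z^k a_k) = z^m, on both sides, gives u a_k = a_k u =
    a_(k-1), plus 1 when k = m. Hence u^m a_(m-1) = 0 and u^(m+1) a_m = u^m, so a_m is the
    quasi-inverse. *)
Lemma pole_op_drazin (X : normedModType R[i]) (t : bop X) (lambda : R[i]) :
  resolvent_pole t lambda -> op_drazin (shift_op t lambda).
Proof.
move=> [m [A [r [m0 r0 hA _ H]]]].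
pose a k := Bop (hA k); pose u : bop X := t - lambda *: (1 : bop X).
have rE : r = (complex.Re r)%:C%C by rewrite RRe_real // gtr0_real.
have rr0 : 0 < complex.Re r by rewrite -ltcR -rE.
pose s (z : R[i]) n := \sum_(k < n) z ^+ k *: a k.
(* The coefficients shifted by one, with a_(-1) = 0. *)
pose a' k := if k is j.+1 then a j else 0.
have Hz z : 0 < rnorm z < complex.Re r -> exists sg : bop X,
    [/\ (u - z *: (1 : bop X)) * sg = 1, sg * (u - z *: (1 : bop X)) = 1 &
      forall e : R, 0 < e -> exists N, forall n, (N <= n)%N ->
         opn (s z n - z ^+ m *: sg) <= e].
  move=> zr; have [|S [hS Sl Sr] hc] := H (lambda + z).
    by rewrite addrAC subrr add0r normE rE !ltcR.
  exists (Bop hS); split.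
  - by apply: bopE => x; rewrite -[LHS]shift_opD; exact: Sr.
  - apply: bopE => x; rewrite bop_mulE -[bop_fun (u - _) x]shift_opD.
    exact: Sl.
  move=> e e0; have [|N _ hN] := hc e%:C%C; first by rewrite ltcR.
  exists N => n Nn; apply: opn_le; first exact: ltW.
  move=> x; have := hN n Nn x; rewrite /= addrAC subrr add0r.
  rewrite !normE -rmorphM /= lecR.
  apply: le_trans; rewrite le_eqVlt; apply/orP; left; apply/eqP; congr rnorm.
  by rewrite -[LHS]/(s z n x - z ^+ m *: S x) bop_sumE.
have key (V : nat -> bop X) : (forall k, V k = u * a k) \/ (forall k, V k = a k * u) ->
    forall k, V k = a' k + (k == m)%:R *: (1 : bop X).
  move=> hV k; apply/eqP; rewrite -subr_eq0; apply/eqP; move: k.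
  apply: (@bop_power_series_eq0 _ _
    (fun k => V k - (a' k + (k == m)%:R *: (1 : bop X))) _ rr0).
  move=> z zr e e0; have [sg [sl sr hc]] := Hz z zr.
  have d0 : 0 < opn u + rnorm z + 1 by rewrite ltr_wpDl // addr_ge0 ?opn_ge0 ?rnorm_ge0.
  have [|N hN] := hc (e / (opn u + rnorm z + 1)); first by rewrite divr_gt0.
  (* A sum of n + 1 terms with n at least m contains the index m, and its shifted part is exactly z
     times [s z n]. *)
  exists (maxn N m).+1 => -[//|n]; rewrite ltnS geq_max => /andP[Nn mn].
  have E1 : \sum_(k < n.+1) z ^+ k *: (V k - (a' k + (val k == m)%:R *: (1 : bop X))) =
      \sum_(k < n.+1) z ^+ k *: V k - z *: s z n - z ^+ m *: (1 : bop X).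
    under eq_bigr do rewrite scalerBr scalerDr.
    rewrite sumrB big_split /= opprD addrA; congr (_ - _ - _).
      rewrite big_ord_recl /= scaler0 add0r scaler_sumr.
      by apply: eq_bigr => i _; rewrite scalerA exprS.
    rewrite (bigD1 (Ordinal (mn : (m < n.+1)%N))) //= eqxx scale1r big1 ?addr0 //.
    move=> i; rewrite -val_eqE /= => /negbTE ->.
    by rewrite scale0r scaler0.
  have zsg (b : bop X) : z *: b = (z *: (1 : bop X)) * b by rewrite -bop_scaleAl mul1r.
  have zsg' (b : bop X) : z *: b = b * (z *: (1 : bop X)) by rewrite -bop_scaleAr mulr1.
  rewrite E1.
  have bound (b c : bop X) : opn b <= opn u * (e / (opn u + rnorm z + 1)) ->
     opn c <= e / (opn u + rnorm z + 1) -> opn (b - z *: c) <= e.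
    move=> hb hcc; apply: le_trans (opnD _ _) _; rewrite opnN.
    apply: le_trans (lerD hb (opnZ _ _)) _.
    apply: le_trans (_ : (opn u + rnorm z) * (e / (opn u + rnorm z + 1)) <= _).
      by rewrite mulrDl lerD2l ler_wpM2l ?rnorm_ge0.
    rewrite mulrA ler_pdivrMr //; move: (addr_ge0 (opn_ge0 u) (rnorm_ge0 z)).
    by move: (opn u + rnorm z) => y; nra.
  have En := hN n Nn; have En1 := hN n.+1 (leqW Nn).
  case: hV => hV.
    have -> : \sum_(k < n.+1) z ^+ k *: V k = u * s z n.+1.
      by rewrite mulr_sumr; apply: eq_bigr => i _; rewrite hV bop_scaleAr.
    have -> : u * s z n.+1 - z *: s z n - z ^+ m *: (1 : bop X) =
        u * (s z n.+1 - z ^+ m *: sg) - z *: (s z n - z ^+ m *: sg).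
      by rewrite -sl bop_scaleAr (mulrBl (_ *: sg)) (mulrBr u) scalerBr
        -zsg !opprD !opprK addrACA.
    apply: bound => //; apply: le_trans (opnM _ _) _.
    by rewrite ler_wpM2l ?opn_ge0.
  have -> : \sum_(k < n.+1) z ^+ k *: V k = s z n.+1 * u.
    by rewrite mulr_suml; apply: eq_bigr => i _; rewrite hV bop_scaleAl.
  have -> : s z n.+1 * u - z *: s z n - z ^+ m *: (1 : bop X) =
      (s z n.+1 - z ^+ m *: sg) * u - z *: (s z n - z ^+ m *: sg).
    by rewrite -sr bop_scaleAl (mulrBr (_ *: sg)) (mulrBl u) scalerBr
      -zsg' !opprD !opprK addrACA.
  apply: bound => //; apply: le_trans (opnM _ _) _.
  by rewrite mulrC ler_wpM2l ?opn_ge0.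
have ua := key (fun k => u * a k) (or_introl (fun=> erefl)).
have au := key (fun k => a k * u) (or_intror (fun=> erefl)).
suff : op_drazin u by [].
apply/op_drazinP; exists m, (a m); split; first by rewrite ua au.
have ukak k : (k < m)%N -> u ^+ k.+1 * a k = 0.
  elim: k => [|k IH] km.
    by rewrite expr1 ua add0r lt_eqF // scale0r.
  rewrite exprSr -mulrA ua /= lt_eqF // scale0r addr0.
  by apply: IH; exact: ltnW.
rewrite exprSr -mulrA ua eqxx scale1r mulrDr mulr1.
by case: m m0 ukak {H Hz key ua au} => // m _ h; rewrite /= h // add0r.
Qed.

End Poles.

Section MeromorphicOperators.
Context {R : realType} {X : completeNormedModType R[i]}.

Lemma bic_sumE (G : commuting X) n (f : 'I_n -> bic G) x :
  bic_val (\sum_i f i) x = \sum_i bic_val (f i) x.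
Proof. by elim/big_ind2: _ => [//|a u b v <- <-|//]. Qed.

(** The coefficients are read off [drazin_resolvent]: the nilpotent part gives the terms below m,
    and expanding g d in powers of z d gives the others. *)
Lemma op_drazin_pole (t : bop X) (lambda : R[i]) :
  op_drazin (shift_op t lambda) -> spectrum t lambda -> resolvent_pole t lambda.
Proof.
pose a : bop X := t - lambda *: (1 : bop X); pose G := commuting1 a.
pose sc := bic_scalar G.
pose u : bic G := bic1 a.
move=> /(bic_drazinP u)/drazinP[m0 [p [d [pp up ud dp]]]] sp.
have p1 : 1 - p != 0.
  apply/negP => /eqP/subr0_eq p1; apply: sp.
  by have /regularP : regular u by exists d; rewrite ud.
have exm : exists m, u ^+ m * (1 - p) == 0 by exists m0; rewrite up.
(* The order of the pole is the least exponent; its minimality makes [A 0] non-zero. *)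
case: (ex_minnP exm) => m /eqP um mmin.
have m_gt0 : (0 < m)%N.
  by case: m um {mmin} => //; rewrite expr0 mul1r => h; rewrite h eqxx in p1.
pose A k : bic G := if (k < m)%N then - (u ^+ (m.-1 - k) * (1 - p)) else d ^+ (k - m).+1.
have [e e0 he] := exists_small_factor (bnorm_ge0 d).
exists m, (fun k => bic_val (A k)), (e%:C)%C; split=> //.
- by rewrite ltcR.
- by move=> k; exact: bopP.
- apply: contrapT => nx; have : A 0%N = 0.
    apply/val_inj/bopE => x; apply: contrapT => /eqP Ax; apply: nx.
    by exists x.
  rewrite /A m_gt0 subn0 => /eqP; rewrite oppr_eq0 => /mmin.
  by rewrite leqNgt prednK // leqnn.
move=> mu; rewrite normE !ltcR => /andP[z0 ze].
set z := mu - lambda in z0 ze *.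
have znz : z != 0 by rewrite -rnorm_gt0.
have zd1 : bnorm (sc z * d) < 1.
  by rewrite (le_lt_trans (bnormZ _ _)) // he // rnorm_ge0.
have [g zg _] := neumann zd1.
have := drazin_resolvent pp up ud dp znz zg.
have := drazin_resolvent pp um ud dp znz zg.
set q := \sum_(i < m) _; set sg := g * d - _ => usg _.
have muE x : shift_op t mu x = bic_val (u - sc z) x.
  by rewrite -[RHS](shift_opD t lambda z) addrC subrK.
exists (bic_val sg).
  split; first exact: bopP.
    move=> x; rewrite muE; have /(congr1 val) := usg.
    rewrite mulrC rmorphM /= => h.
    by rewrite -[LHS]/((bic_val sg * bic_val (u - sc z)) x) h.
  move=> x; rewrite muE; have /(congr1 val) := usg.
  rewrite rmorphM /= => h.
  by rewrite -[LHS]/((bic_val (u - sc z) * bic_val sg) x) h.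
pose B n : bic G := \sum_(k < n) sc z ^+ k * A k - sc z ^+ m * sg.
(* The remainder is exact and decays geometrically, since [bnorm (sc z * d)] is below 1. *)
have BE j : B (m + j)%N = - (sc z ^+ m * (g * d)) * (sc z * d) ^+ j.
  elim: j => [|j IH].
    rewrite addn0 expr0 mulr1 /B.
    have -> : \sum_(k < m) sc z ^+ k * A k = - (q * (1 - p)).
      rewrite /q mulr_suml -sumrN; apply: eq_bigr => i _.
      by rewrite /A ltn_ord; move: (u ^+ _) => y; ring.
    have zm : sc z ^+ m * sc z^-1 ^+ m = 1.
      by rewrite -exprMn [_ * sc _]mulrC bic_scalarVl // expr1n.
    rewrite (_ : - _ - _ = - (sc z ^+ m * (g * d)) +
      (sc z ^+ m * sc z^-1 ^+ m - 1) * (q * (1 - p))); last by rewrite /sg; ring.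
    by rewrite zm subrr mul0r addr0.
  have -> : B (m + j.+1)%N = B (m + j)%N + sc z ^+ (m + j) * d ^+ j.+1.
    rewrite addnS /B big_ord_recr /= addrAC /A ltnNge leq_addr /=.
    by rewrite addKn.
  rewrite IH exprD !exprMn !exprS.
  rewrite {1}(_ : sc z ^+ m * (g * d) =
    sc z ^+ m * d * ((1 - sc z * d) * g + sc z * d * g)); last by ring.
  rewrite zg; move: (d ^+ j) (sc z ^+ j) => y y'; ring.
move=> eps eps0.
have epsE : eps = (complex.Re eps)%:C%C by rewrite RRe_real // gtr0_real.
have reps0 : 0 < complex.Re eps by rewrite -ltcR -epsE.
have hq : 0 <= bnorm (sc z * d) < 1 by rewrite bnorm_ge0.
have [N hN] := geometric_small (bnorm (- (sc z ^+ m * (g * d)))) hq reps0.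
exists (m + N)%N => // n /= mNn x.
have bnE : bnorm (B n) <= complex.Re eps.
  have mn : (m <= n)%N by apply: leq_trans mNn; exact: leq_addr.
  rewrite -(subnKC mn) BE; apply: le_trans (bnormM _ _) _.
  apply: le_trans (ler_wpM2l (bnorm_ge0 _) (bnormX _ _)) _.
  by apply/ltW/hN; rewrite leq_subRL.
have -> : \sum_(k < n) z ^+ k *: A k x - z ^+ m *: sg x = bic_val (B n) x.
  rewrite -[RHS]/(bic_val (\sum_(k < n) sc z ^+ k * A k) x - bic_val (sc z ^+ m * sg) x).
  rewrite bic_sumE -!rmorphXn bic_scalarE; congr (_ - _).
  by apply: eq_bigr => i _; rewrite -!rmorphXn bic_scalarE.
move: (B n) bnE => b hb.
rewrite !normE epsE -rmorphM /= lecR; apply: le_trans (opnP _ _) _.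
by rewrite ler_wpM2r ?rnorm_ge0.
Qed.

Lemma meromorphicP (T : X -> X) : bounded_operator T ->
  meromorphic T <-> forall lambda, lambda != 0 -> op_drazin (shift_op T lambda).
Proof.
move=> hT; split=> [mT l l0|dT l sl l0]; last first.
  by apply: (@op_drazin_pole (Bop hT)) => //; exact: dT.
have [sl|/contrapT [S hS]] := pselect (spectrum T l).
  by apply: (@pole_op_drazin _ _ (Bop hT)); exact: mT.
exact: op_drazin_inverse hS.
Qed.

End MeromorphicOperators.

(** * The open mapping theorem *)

Lemma rclosedP (R : realType) (X : normedModType R[i]) (A : set X) :
  closed A <->
  forall x, (forall e : R, 0 < e -> exists2 y, A y & rnorm (x - y) < e) -> A x.
Proof.
split=> [cA x hx|h x clx]; first apply: cA.
  move=> B /nbhs_ballP[e /= e0 eB].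
  have eE : e = (complex.Re e)%:C%C by rewrite RRe_real // gtr0_real.
  have [|y Ay xy] := hx (complex.Re e); first by rewrite -ltcR -eE.
  exists y; split=> //; apply: eB.
  by rewrite -ball_normE /ball_ /= normE eE ltcR.
apply: h => e e0.
have [|y [Ay]] := clx (ball x e%:C%C); first by apply: nbhsx_ballx; rewrite ltcR.
by rewrite -ball_normE /ball_ /= normE ltcR => xy; exists y.
Qed.

Section OpenMapping.
Context {R : realType}.

Definition bounded_linear (Y X : normedModType R[i]) (f : Y -> X) :=
  linear f /\ exists2 k : R, 0 <= k & forall y, rnorm (f y) <= k * rnorm y.

Section BoundedLinear.
Context {Y X : normedModType R[i]} (f : Y -> X) (hf : bounded_linear f).

Lemma blinD x y : f (x + y) = f x + f y.
Proof. by have [h _] := hf; have := h 1 x y; rewrite !scale1r. Qed.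

Lemma blin0 : f 0 = 0.
Proof. by apply: (addrI (f 0)); rewrite -blinD !addr0. Qed.

Lemma blinZ k x : f (k *: x) = k *: f x.
Proof. by have [h _] := hf; have := h k x 0; rewrite !addr0 blin0 addr0. Qed.

Lemma blinB x y : f (x - y) = f x - f y.
Proof. by rewrite blinD -scaleN1r blinZ scaleN1r. Qed.

End BoundedLinear.

Context {Y1 Y2 X : completeNormedModType R[i]} (f1 : Y1 -> X) (f2 : Y2 -> X).
Context (hf1 : bounded_linear f1) (hf2 : bounded_linear f2).

(** Two maps serve sums of two subspaces without a product Banach space; for a single map the other
    one is taken to be 0. *)
Let Z : set X := [set x | exists y1 y2, x = f1 y1 + f2 y2].

Context (Zclosed : closed Z).

Let E (r : R) : set X := [set x | exists y1 y2,
  [/\ x = f1 y1 + f2 y2, rnorm y1 <= r & rnorm y2 <= r]].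

Let Z_sub x y : Z x -> Z y -> Z (x - y).
Proof.
move=> [a [b ->]] [c [d ->]]; exists (a - c), (b - d).
by rewrite (blinB hf1) (blinB hf2) opprD addrACA.
Qed.

Let E_sub r x y : E r x -> E r y -> E (2 * r) (x - y).
Proof.
move=> [a [b [-> ar br]]] [c [d [-> cr dr]]]; exists (a - c), (b - d); split.
- by rewrite (blinB hf1) (blinB hf2) opprD addrACA.
- by have := rnormB_le a c; lra.
- by have := rnormB_le b d; lra.
Qed.

(** Otherwise every ball centred in [Z] contains a smaller one, centred in [Z], that misses [E n];
    the nested balls shrink to a point of the closed set [Z] lying in no [E n]. *)
Let baire : exists n x0 r, [/\ Z x0, 0 < r & forall z, Z z -> rnorm (z - x0) < r ->
  forall e : R, 0 < e -> exists2 w, E n%:R w & rnorm (z - w) < e].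
Proof.
apply: contrapT => nb.
have step (p : nat * X * R) : exists q : X * R, Z p.1.2 -> 0 < p.2 ->
   [/\ Z q.1, 0 < q.2, rnorm (q.1 - p.1.2) + q.2 <= p.2, q.2 <= p.2 / 2 &
      forall w, E (p.1.1)%:R w -> q.2 < rnorm (q.1 - w)].
  case: p => [[n x] r] /=; have [[Zx r0]|h] := pselect (Z x /\ 0 < r); last first.
    by exists (0, 0) => Zx r0; case: h.
  apply: contrapT => nq; apply: nb; exists n, x, r; split=> // z Zz zx e e0.
  apply: contrapT => nw; apply: nq.
  (* The three terms keep the new ball away from [E n], inside the old ball, and of at most half its
     radius. *)
  pose s := Num.min (e / 2) (Num.min (r - rnorm (z - x)) (r / 2)).
  have s1 : s <= e / 2 by rewrite ge_min lexx.
  have s2 : s <= r - rnorm (z - x) by rewrite !ge_min lexx orbT.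
  have s3 : s <= r / 2 by rewrite !ge_min lexx !orbT.
  exists (z, s) => _ _ /=; split=> //.
  - by rewrite !lt_min subr_gt0 zx !divr_gt0.
  - by move: s2; rewrite -lerBrDl.
  - move=> w Ew; rewrite ltNge; apply/negP => zw; apply: nw; exists w => //.
    by apply: le_lt_trans zw _; apply: le_lt_trans s1 _; lra.
have [F hF] := choice step.
pose u := fix u n : X * R := if n is k.+1 then F (k, (u k).1, (u k).2) else (0, 1).
have Z0 : Z 0 by exists 0, 0; rewrite (blin0 hf1) (blin0 hf2) addr0.
have uP n : Z (u n).1 /\ 0 < (u n).2.
  elim: n => [|n [Zn un0]] //=.
  by have [] := hF (n, (u n).1, (u n).2) Zn un0.
have uS n := hF (n, (u n).1, (u n).2) (uP n).1 (uP n).2.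
have rn n : (u n).2 <= (1 / 2) ^+ n.
  elim: n => [|n IH]; first by rewrite expr0.
  have [_ _ _ h _] := uS n; apply: le_trans h _.
  by rewrite /= exprS; lra.
have hq : 0 <= (1 / 2 : R) < 1 by apply/andP; split; lra.
have [|l hl] := @geometric_cvg _ X (fun n => (u n).1) 1 (1 / 2) hq.
  move=> n; rewrite mul1r; apply: le_trans (rn n).
  have [_ h0 h _ _] := uS n; apply: le_trans h.
  by rewrite lerDl ltW.
have {}hl n : rnorm ((u n).1 - l) <= 2 * (1 / 2) ^+ n.
  by have := hl n; rewrite (_ : 1 / (1 - 1 / 2) = 2 :> R) //; field.
have nest m k : rnorm ((u (k + m)%N).1 - (u m).1) + (u (k + m)%N).2 <= (u m).2.
  elim: k => [|k IH]; first by rewrite subrr rnorm0 add0r.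
  have [_ _ h _ _] := uS (k + m)%N.
  have := rnorm_dist (u (k + m).+1).1 (u (k + m)%N).1 (u m).1.
  by move: h IH; rewrite addSn /=; lra.
have lr m : rnorm ((u m).1 - l) <= (u m).2.
  rewrite -subr_le0; apply: (@le0_geometric _ _ 2 _ hq) => k.
  have h1 := nest m k; have h2 := hl (k + m)%N.
  have h3 := rnorm_dist (u m).1 (u (k + m)%N).1 l; rewrite rnormB in h1.
  have h4 := (uP (k + m)%N).2.
  have h5 : (1 / 2 : R) ^+ (k + m) <= (1 / 2) ^+ k.
    by rewrite exprD ler_piMr ?exprn_ge0 // ?exprn_ile1 //; lra.
  lra.
have [y1 [y2 ly]] : Z l.
  have /rclosedP := Zclosed; apply => e e0.
  have [N hN] := geometric_small 1 hq e0.
  exists (u N).1; first by have [] := uP N.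
  rewrite rnormB; apply: le_lt_trans (lr N) _; apply: le_lt_trans (rn N) _.
  by have := hN N (leqnn _); rewrite mul1r.
pose M := Num.max (rnorm y1) (rnorm y2).
have [n Mn] : exists n : nat, M <= n%:R.
  exists (Num.bound M); apply/ltW/archi_boundP.
  by rewrite le_max rnorm_ge0.
have [_ _ _ _ /(_ l)] := uS n; rewrite ltNge => h.
have /negP := h (ltac:(exists y1, y2; split=> //; apply: le_trans Mn;
  by rewrite le_max lexx ?orbT)).
by apply; exact: (lr n.+1).
Qed.

Let approx : exists2 C : R, 0 <= C & forall z, Z z -> exists y1 y2,
  [/\ rnorm y1 <= C * rnorm z, rnorm y2 <= C * rnorm z &
     rnorm (z - (f1 y1 + f2 y2)) <= rnorm z / 2].
Proof.
have [n [x0 [r [Zx0 r0 hd]]]] := baire.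
have C0 : 0 <= 2 * n%:R / (r / 2).
  by rewrite divr_ge0 ?mulr_ge0 ?ler0n // ltW // divr_gt0.
exists (2 * n%:R / (r / 2)) => // z Zz.
have [z0|z0] := leP (rnorm z) 0.
  exists 0, 0; rewrite !rnorm0 (blin0 hf1) (blin0 hf2) addr0 subr0; split.
  - by rewrite mulr_ge0 ?rnorm_ge0.
  - by rewrite mulr_ge0 ?rnorm_ge0.
  - by rewrite (rnorm0_eq0 z0) rnorm0 mul0r.
pose k := rnorm z / (r / 2); have k0 : 0 < k by rewrite !divr_gt0.
have kN (V : normedModType R[i]) (v : V) : rnorm ((k%:C)%C *: v) = k * rnorm v.
  by rewrite rnormZ rnorm_real gtr0_norm.
pose z' := (k^-1%:C)%C *: z.
have kn0 : k != 0 by rewrite gt_eqF.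
have rn0 : r / 2 != 0 by rewrite gt_eqF // divr_gt0.
have kr : k * (r / 2) = rnorm z by rewrite /k divfK.
have zz' : z = (k%:C)%C *: z'.
  by rewrite scalerA -rmorphM /= divff // scale1r.
have z'r : rnorm z' < r.
  rewrite rnormZ rnorm_real gtr0_norm ?invr_gt0 // /k invf_div.
  by rewrite divfK ?gt_eqF //; lra.
have Zz' : Z z'.
  have [a [b zE]] := Zz; exists ((k^-1%:C)%C *: a), ((k^-1%:C)%C *: b).
  by rewrite /z' zE (blinZ hf1) (blinZ hf2) -scalerDr.
have Zx0z' : Z (x0 + z').
  have -> : x0 + z' = x0 - (z' - z' - z') by rewrite subrr sub0r opprK.
  by do !apply: Z_sub.
(* The rescaled vector has norm r/2; two errors of r/8, at [x0 + z'] and at [x0], add up to half of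
   it. *)
have r8 : 0 < r / 8 by rewrite divr_gt0.
have [|w Ew zw] := hd _ Zx0z' _ _ r8; first by rewrite addrAC subrr add0r.
have [|w' Ew' zw'] := hd _ Zx0 _ _ r8; first by rewrite subrr rnorm0.
have [y1 [y2 [vE hy1 hy2]]] := E_sub Ew Ew'.
have kle (V : normedModType R[i]) (v : V) : rnorm v <= 2 * n%:R ->
    rnorm ((k%:C)%C *: v) <= 2 * n%:R / (r / 2) * rnorm z.
  move=> hv; rewrite kN (_ : _ * rnorm z = k * (2 * n%:R)); last by rewrite /k; ring.
  by rewrite ler_wpM2l // ltW.
exists ((k%:C)%C *: y1), ((k%:C)%C *: y2); split; [exact: kle|exact: kle|].
rewrite (blinZ hf1) (blinZ hf2) -scalerDr -vE {1}zz' -scalerBr kN -kr -mulrA.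
rewrite ler_wpM2l ?(ltW k0) //.
have -> : z' - (w - w') = (x0 + z' - w) - (x0 - w').
  by rewrite !opprB [x0 + z']addrC [z' + x0 - w]addrAC addrACA subrr addr0 addrA addrAC.
have := rnormB_le (x0 + z' - w) (x0 - w'); lra.
Qed.

(** Each correction by [approx] halves the residual, so the corrections sum to at most twice the
    first bound and converge by completeness. *)
Lemma open_mapping : exists2 C : R, 0 <= C & forall z, Z z -> exists y1 y2,
  [/\ z = f1 y1 + f2 y2, rnorm y1 <= C * rnorm z & rnorm y2 <= C * rnorm z].
Proof.
have [C C0 hC] := approx.
have step (z : X) : exists y : Y1 * Y2, Z z ->
    [/\ rnorm y.1 <= C * rnorm z, rnorm y.2 <= C * rnorm z &
     rnorm (z - (f1 y.1 + f2 y.2)) <= rnorm z / 2].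
  have [/hC[y1 [y2 h]]|h] := pselect (Z z); last by exists (0, 0).
  by exists (y1, y2).
have [h hh] := choice step.
exists (2 * C) => [|z Zz]; first by rewrite mulr_ge0.
pose t := fix t n : X := if n is k.+1 then t k - (f1 (h (t k)).1 + f2 (h (t k)).2) else z.
have tZ n : Z (t n).
  by elim: n => //= n IH; apply: Z_sub => //; exists (h (t n)).1, (h (t n)).2.
have tn n : rnorm (t n) <= rnorm z * (1 / 2) ^+ n.
  elim: n => [|n IH]; first by rewrite expr0 mulr1.
  have [_ _ h1] := hh _ (tZ n); rewrite exprS /=; lra.
pose s1 n := \sum_(k < n) (h (t k)).1; pose s2 n := \sum_(k < n) (h (t k)).2.
have ts n : z = t n + (f1 (s1 n) + f2 (s2 n)).
  elim: n => [|n IH]; first by rewrite /s1 /s2 !big_ord0 (blin0 hf1) (blin0 hf2) !addr0.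
  rewrite {1}IH /s1 /s2 !big_ord_recr /= (blinD hf1) (blinD hf2).
  by rewrite [X in _ = _ + X]addrACA [X in _ = _ + X]addrC [RHS]addrA subrK.
have hq : 0 <= (1 / 2 : R) < 1 by apply/andP; split; lra.
have c2 : C * rnorm z / (1 - 1 / 2) = 2 * C * rnorm z by field.
have [|l1 hl1] := @geometric_cvg _ Y1 s1 (C * rnorm z) (1 / 2) hq.
  move=> n; rewrite /s1 big_ord_recr /= [X in X - _]addrC addrK.
  have [h1 _ _] := hh _ (tZ n); apply: le_trans h1 _.
  by rewrite -mulrA ler_wpM2l.
have [|l2 hl2] := @geometric_cvg _ Y2 s2 (C * rnorm z) (1 / 2) hq.
  move=> n; rewrite /s2 big_ord_recr /= [X in X - _]addrC addrK.
  have [_ h1 _] := hh _ (tZ n); apply: le_trans h1 _.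
  by rewrite -mulrA ler_wpM2l.
rewrite c2 in hl1 hl2.
exists l1, l2; split; last first.
- by have := hl2 0%N; rewrite /s2 big_ord0 add0r rnormN expr0 mulr1.
- by have := hl1 0%N; rewrite /s1 big_ord0 add0r rnormN expr0 mulr1.
have [_ [k1 k10 hk1]] := hf1; have [_ [k2 k20 hk2]] := hf2.
apply/eqP; rewrite -subr_eq0; apply/eqP/rnorm0_eq0.
apply: (@le0_geometric _ _
  (rnorm z + (k1 * (2 * C * rnorm z) + k2 * (2 * C * rnorm z))) _ hq) => n.
have -> : z - (f1 l1 + f2 l2) = t n + (f1 (s1 n - l1) + f2 (s2 n - l2)).
  by rewrite {1}(ts n) (blinB hf1) (blinB hf2) -addrA opprD [in LHS]addrACA.
rewrite (le_trans (rnormD_le _ _)) // mulrDl lerD //.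
rewrite (le_trans (rnormD_le _ _)) // mulrDl lerD //.
  by rewrite (le_trans (hk1 _)) // -mulrA ler_wpM2l // hl1.
by rewrite (le_trans (hk2 _)) // -mulrA ler_wpM2l // hl2.
Qed.

End OpenMapping.

(** * Direct sums and B-Browder operators *)

Section Kernels.
Context {R : realType} {X : normedModType R[i]}.

Definition bker (a : bop X) : {pred X} := [pred x | a x == 0].

Lemma bker_submod_closed (a : bop X) : GRing.submod_closed (bker a).
Proof.
split=> [|k x y]; rewrite !inE ?bop0 // => /eqP ax /eqP ay.
by rewrite bopD bopZ ax ay scaler0 addr0.
Qed.

HB.instance Definition _ (a : bop X) :=
  GRing.isSubmodClosed.Build R[i] X (bker a) (bker_submod_closed a).

Lemma bker_closed (a : bop X) : closed [set x | x \in bker a].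
Proof.
apply/rclosedP => x hx; rewrite /= inE; apply/eqP/rnorm0_eq0.
apply/ler_addgt0Pr => e e0; rewrite add0r.
have a1 : 0 < opn a + 1 by rewrite ltr_wpDl // opn_ge0.
have [|y] := hx (e / (opn a + 1)); first by rewrite divr_gt0.
rewrite /= inE => /eqP ay xy.
rewrite -[a x]subr0 -ay -bopB; apply: le_trans (opnP _ _) _.
move: xy; rewrite ltr_pdivlMr // => /ltW; apply: le_trans.
by rewrite mulrC ler_wpM2l ?rnorm_ge0 // lerDl.
Qed.

(** Every closed subspace constructed below has this form: the range of an idempotent p is obtained
    as the kernel of 1 - p. *)
Definition kernel_subspace (a : bop X) : closed_subspace X :=
  @ClosedSubspace _ X (bker a) (@bker_closed a).

Lemma kernel_subspaceP (a : bop X) x :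
  reflect (a x = 0) (x \in kernel_subspace a).
Proof. exact: eqP. Qed.

Lemma kernel_invariant (a b : bop X) : a * b = b * a ->
  Defs.invariant b (kernel_subspace a).
Proof.
move=> ab x /kernel_subspaceP ax; apply/kernel_subspaceP.
by rewrite -bop_mulE ab bop_mulE ax bop0.
Qed.

End Kernels.

Section Restrictions.
Context {R : realType} {X : normedModType R[i]}.
Implicit Types (M N : closed_subspace X).

Lemma subspace0 M : 0 \in M.
Proof. exact: (@rpred0 _ (cs_space M)). Qed.

Lemma subspaceD M x y : x \in M -> y \in M -> x + y \in M.
Proof. exact: (@rpredD _ (cs_space M)). Qed.

Lemma subspaceZ M k x : x \in M -> k *: x \in M.
Proof. exact: (@rpredZ _ _ (cs_space M)). Qed.

Lemma subspaceB M x y : x \in M -> y \in M -> x - y \in M.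
Proof. by move=> xM yM; rewrite -scaleN1r subspaceD ?subspaceZ. Qed.

Lemma val_restr T M (TM : Defs.invariant T M) x : val (restr TM x) = T (val x).
Proof. by []. Qed.

Lemma val_iter_restr T M (TM : Defs.invariant T M) n x :
  val (iter n (restr TM) x) = iter n T (val x).
Proof. by elim: n => //= n ->. Qed.

Lemma rnorm_val M (x : subsp M) : rnorm (val x) = rnorm x.
Proof. by []. Qed.

Lemma valD M (x y : subsp M) : val (x + y) = val x + val y.
Proof. by []. Qed.

Lemma valZ M k (x : subsp M) : val (k *: x) = k *: val x.
Proof. by []. Qed.

Lemma restr_bounded T M (TM : Defs.invariant T M) :
  bounded_operator T -> bounded_operator (restr TM).
Proof.
move=> hT; pose t := Bop hT.
apply: (@mk_bop_subproof _ _ _ (opn t)) => [k x y|x].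
  apply: val_inj; rewrite val_restr !valD !valZ !val_restr.
  by rewrite -[T]/(t : X -> X) bopD bopZ.
exact: (opnP t).
Qed.

Lemma val_bounded_linear M : bounded_linear (fun x : subsp M => val x).
Proof. by split=> //; exists 1 => // x; rewrite mul1r. Qed.

Lemma shift_invariant T M z : Defs.invariant T M -> Defs.invariant (shift_op T z) M.
Proof. by move=> TM x xM; rewrite /shift_op subspaceB ?subspaceZ ?TM //. Qed.

Lemma shift_restr T M z (TM : Defs.invariant T M) (TzM : Defs.invariant (shift_op T z) M) :
  shift_op (restr TM) z = restr TzM.
Proof. by apply/funext => x; apply: val_inj. Qed.

Lemma bounded_linear_bop (a : bop X) : bounded_linear a.
Proof. by have [h1] := bopP a; split=> //; exact: bop_bound. Qed.

Lemma shift_bounded (T : X -> X) z : bounded_operator T -> bounded_operator (shift_op T z).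
Proof. by move=> hT; exact: (bopP (Bop hT - z *: (1 : bop X))). Qed.

End Restrictions.

Section DirectSums.
Context {R : realType} {X : completeNormedModType R[i]}.

(** Uniqueness of the decomposition makes the chosen component linear, and the open mapping theorem
    makes it bounded. *)
Lemma direct_sum_projection (M N : closed_subspace X) : direct_sum M N ->
  exists p : bop X, [/\ forall x, p x \in M, forall x, x - p x \in N,
    forall x, x \in M -> p x = x & forall x, x \in N -> p x = 0].
Proof.
move=> [sp dj].
have uniq x y y' : y \in M -> y' \in M -> x - y \in N -> x - y' \in N -> y = y'.
  move=> yM y'M xy xy'; apply/eqP; rewrite -subr_eq0; apply/eqP/dj.
    by rewrite subspaceB.
  have -> : y - y' = (x - y') - (x - y) by rewrite opprB [RHS]addrC [RHS]addrA subrK.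
  by rewrite subspaceB.
pose Z : set X := [set x | exists (y1 : subsp M) (y2 : subsp N), x = val y1 + val y2].
have ZT x : Z x.
  by have [y [z [yM zN ->]]] := sp x; exists (exist _ y yM), (exist _ z zN).
have cZ : closed Z by rewrite (_ : Z = setT) //; apply/seteqP; split.
have [C C0 hC] := open_mapping (val_bounded_linear M) (val_bounded_linear N) cZ.
have /choice[p hp] x : exists y, [/\ y \in M, x - y \in N & rnorm y <= C * rnorm x].
  have [y1 [y2 [xE h1 _]]] := hC x (ZT x); exists (val y1); split=> //.
    exact: valP.
  by rewrite xE addrC addKr; exact: valP.
have pb : bounded_operator p.
  apply: (@mk_bop_subproof _ _ _ C) => [k x y|x]; last by have [] := hp x.
  have [xM xN _] := hp x; have [yM yN _] := hp y; have [zM zN _] := hp (k *: x + y).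
  apply: uniq zM _ zN _; first by rewrite subspaceD ?subspaceZ.
  by rewrite opprD addrACA -scalerBr subspaceD ?subspaceZ.
exists (Bop pb); split=> x /=.
- by have [] := hp x.
- by have [] := hp x.
- by move=> xM; have [pM pN _] := hp x; apply: uniq pM xM pN _; rewrite subrr subspace0.
- move=> xN; have [pM pN _] := hp x; apply: uniq pM _ pN _; first exact: subspace0.
  by rewrite subr0.
Qed.

Lemma direct_sum_drazin (T : X -> X) (M N : closed_subspace X)
    (TM : Defs.invariant T M) (TN : Defs.invariant T N) :
  bounded_operator T -> direct_sum M N ->
  op_drazin (restr TM) -> op_drazin (restr TN) -> op_drazin T.
Proof.
move=> hT /direct_sum_projection[p [pM pN pMid pN0]].
pose t := Bop hT; pose u1 := Bop (restr_bounded TM hT);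
pose u2 := Bop (restr_bounded TN hT).
move=> /(op_drazinP u1)[m1 [b1 [ub1 hm1]]] /(op_drazinP u2)[m2 [b2 [ub2 hm2]]].
pose m := maxn m1 m2.
have {hm1} h1 := drazin_exp_le (leq_maxl m1 m2) hm1.
have {hm2} h2 := drazin_exp_le (leq_maxr m1 m2) hm2.
pose P1 x : subsp M := exist (fun y => y \in M) (p x) (pM x).
pose P2 x : subsp N := exist (fun y => y \in N) (x - p x) (pN x).
have xE x : x = val (P1 x) + val (P2 x) by rewrite /= addrC subrK.
pose B x := val (b1 (P1 x)) + val (b2 (P2 x)).
have P1l k x y : P1 (k *: x + y) = k *: P1 x + P1 y.
  by apply: val_inj; rewrite valD valZ /= bopD bopZ.
have P2l k x y : P2 (k *: x + y) = k *: P2 x + P2 y.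
  apply: val_inj; rewrite valD valZ /= bopD bopZ scalerBr.
  by rewrite opprD addrACA.
have P2b x : rnorm (P2 x) <= (1 + opn p) * rnorm x.
  by rewrite mulrDl mul1r (le_trans (rnormB_le _ _)) // lerD2l opnP.
have hB : bounded_operator B.
  apply: (@mk_bop_subproof _ _ _ (opn b1 * opn p + opn b2 * (1 + opn p))) => [k x y|x].
    by rewrite /B P1l P2l !bopD !bopZ !valD !valZ scalerDr addrACA.
  rewrite (le_trans (rnormD_le _ _)) // mulrDl lerD // !rnorm_val.
    by rewrite (le_trans (opnP _ _)) // -mulrA ler_wpM2l ?opn_ge0 // opnP.
  by rewrite (le_trans (opnP _ _)) // -mulrA ler_wpM2l ?opn_ge0.
have P1T x : P1 (T x) = u1 (P1 x).
  apply: val_inj; rewrite /= -[T]/(t : X -> X) {1}(xE x) bopD bopD.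
  rewrite (pMid (t (val (P1 x)))); last exact: (TM _ (pM x)).
  by rewrite (pN0 (t (val (P2 x)))) ?addr0 //; exact: (TN _ (pN x)).
have P2T x : P2 (T x) = u2 (P2 x).
  apply: val_inj; rewrite /= -[T]/(t : X -> X).
  have /(congr1 val) /= := P1T x; rewrite -[T]/(t : X -> X) => ->.
  by rewrite bopB.
exists m, B; split=> // x.
  rewrite /B P1T P2T -!bop_mulE -ub1 -ub2 !bop_mulE.
  by rewrite -[T]/(t : X -> X) bopD.
rewrite -[T]/(t : X -> X) -!bop_expE {1}(xE x) /B (bopD (t ^+ m))
  (bopD (t ^+ m.+1)) !bop_expE.
have v1 n y : iter n T (val y) = val ((u1 ^+ n) y).
  by rewrite bop_expE -(val_iter_restr TM).
have v2 n y : iter n T (val y) = val ((u2 ^+ n) y).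
  by rewrite bop_expE -(val_iter_restr TN).
by rewrite -[bop_fun t]/T !v1 !v2 h1 h2.
Qed.

Lemma kernel_drazin (G : commuting X) (u q : bic G)
    (uq : Defs.invariant u (kernel_subspace q)) :
  drazin u -> op_drazin (restr uq).
Proof.
move=> [m [b hm]].
have bq : Defs.invariant b (kernel_subspace q).
  apply: kernel_invariant; have := congr1 val (mulrC q b).
  by rewrite !rmorphM.
exists m, (restr bq); split; first exact: restr_bounded (bopP _).
  move=> x; apply: val_inj; rewrite !val_restr.
  have := congr1 val (mulrC u b); rewrite !rmorphM /= => h.
  by rewrite -[LHS]/((bic_val u * bic_val b) (val x)) h.
move=> x; apply: val_inj; rewrite !val_iter_restr val_restr -!bop_expE.
have := congr1 val hm; rewrite rmorphM !rmorphXn /= => ->.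
by rewrite bop_mulE.
Qed.

End DirectSums.

Section BrowderOperators.
Context {R : realType} {X : completeNormedModType R[i]}.

(** The range of t^m is the range of p, where t is bijective with inverse d, so kernel, cokernel,
    ascent and descent are all trivial. *)
Lemma drazin_B_Browder (t : bop X) : op_drazin t -> B_Browder t.
Proof.
pose u := bic1 t; move=> /(bic_drazinP u)/drazinP[m [p [d [pp up ud dp]]]].
have pE : p = u ^+ m * (d ^+ m * p).
  rewrite mulrA -exprMn ud; elim: m {up} => [|m IH]; first by rewrite expr0 mul1r.
  by rewrite exprS -mulrA -IH pp.
have um : u ^+ m = p * u ^+ m.
  by apply/eqP; rewrite -subr_eq0 -up mulrBr mulr1 [_ * p]mulrC.
pose q := 1 - p.
have TM : Defs.invariant t (kernel_subspace q).
  by apply: kernel_invariant; have := congr1 val (mulrC q u); rewrite !rmorphM.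
have inM x : reflect (bic_val p x = x) (x \in kernel_subspace q).
  apply: (iffP (kernel_subspaceP _ _)) => [h|px].
    by apply/eqP; rewrite eq_sym -subr_eq0; apply/eqP.
  by rewrite -[LHS]/(x - bic_val p x) px subrr.
have mulE (a b c : bic (commuting1 t)) x : a = b * c ->
    bic_val a x = bic_val b (bic_val c x).
  by move=> ->.
have expE n x : iter n t x = bic_val (u ^+ n) x.
  have -> : bic_val (u ^+ n) = t ^+ n := rmorphXn val n u.
  by rewrite bop_expE.
exists m, (kernel_subspace q), TM; split.
  apply/seteqP; split=> [x /inM px|_ [x _ <-]] /=.
    by exists (bic_val (d ^+ m * p) x) => //; rewrite expE -(mulE _ _ _ _ pE).
  by apply/inM; rewrite expE -(mulE _ _ _ _ um).
have dM x : bic_val d x \in kernel_subspace q.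
  by apply/inM; rewrite -(mulE d p d) // mulrC dp.
have inj (x : subsp (kernel_subspace q)) : restr TM x = 0 -> x = 0.
  move=> /(congr1 val); rewrite val_restr /= => tx.
  apply: val_inj => /=; have /inM <- := valP x.
  by rewrite (mulE p d u) ?[d * u]mulrC ?ud // -[bic_val u _]/(t _) tx bop0.
have surj (x : subsp (kernel_subspace q)) : exists y, restr TM y = x.
  exists (exist (fun y => y \in kernel_subspace q) (bic_val d (val x)) (dM (val x))).
  apply: val_inj; rewrite val_restr /=.
  by rewrite -[LHS](mulE _ _ _ (val x) (erefl (u * d))) ud; apply/inM/valP.
split; first split.
- exists 0%N, (fun _ => 0); apply/seteqP; split=> [x /inj ->|_ [c _ <-]] /=.
    by exists (fun _ => 0) => //; rewrite big_ord0.
  by rewrite big_ord0; apply: val_inj; exact: bop0.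
- exists 0%N, (fun _ => 0) => x; exists (fun _ => 0).
  by rewrite big_ord0 subr0; have [y <-] := surj x; exists y.
- exists 0%N; apply/seteqP; split=> x; rewrite /=; last by move=> /inj.
  by move=> x0; rewrite (x0 : x = 0); apply: val_inj; exact: bop0.
- exists 0%N; apply/seteqP; split=> [x _|//] /=.
  by have [y <-] := surj x; exists y.
Qed.

(* Finite ascent and descent: with p beyond both, X is the sum of the range of
   t^(2p+1) and the kernel of t^p; the open mapping theorem gives preimages of
   controlled norm, hence a bounded Drazin inverse. *)
Lemma ascent_descent_drazin (t : bop X) (p : nat) :
  (forall x, (t ^+ p.+1) x = 0 -> (t ^+ p) x = 0) ->
  (forall y, exists x, (t ^+ p) y = (t ^+ p.+1) x) -> op_drazin t.
Proof.
move=> asc desc.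
have texp k l x : (t ^+ (k + l)) x = (t ^+ k) ((t ^+ l) x) by rewrite exprD.
have ascn k x : (t ^+ (p + k)) x = 0 -> (t ^+ p) x = 0.
  elim: k => [|k IH]; first by rewrite addn0.
  by rewrite addnS -addSn texp => /asc; rewrite -texp; exact: IH.
have descn k y : exists x, (t ^+ p) y = (t ^+ (p + k)) x.
  elim: k y => [|k IH] y; first by exists y; rewrite addn0.
  have [x ->] := IH y; have [z h] := desc x; exists z.
  by rewrite addnC texp h -texp [(k + _)%N]addnC addSnnS.
(* With B = t^(2p) h one gets t^(p+1) B = t^(3p+1) h = t^(p+q) h = t^p. *)
pose q := p.*2.+1.
pose Z : set X := [set x | exists (y1 : X) (y2 : subsp (kernel_subspace (t ^+ p))),
  x = (t ^+ q) y1 + val y2].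
have ZT y : Z y.
  have [x h] := descn q y.
  have yx : y - (t ^+ q) x \in kernel_subspace (t ^+ p).
    by apply/kernel_subspaceP; rewrite bopB h texp subrr.
  by exists x, (exist (fun z => z \in kernel_subspace (t ^+ p)) _ yx);
    rewrite /= addrC subrK.
have cZ : closed Z by rewrite (_ : Z = setT) //; apply/seteqP; split.
have [C C0 hC] := open_mapping (bounded_linear_bop (t ^+ q)) (val_bounded_linear _) cZ.
have /choice[h hh] y : exists x, (t ^+ p) y = (t ^+ (p + q)) x /\
    rnorm x <= C * rnorm y.
  have [x [v [-> xC _]]] := hC y (ZT y); exists x; split=> //.
  rewrite bopD; have /kernel_subspaceP -> := valP v.
  by rewrite addr0 texp.
have hh1 y : (t ^+ p) y = (t ^+ (p + q)) (h y) by have [] := hh y.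
pose B y := (t ^+ p.*2) (h y).
(* Two choices of [h y] differ by an element of the kernel of t^(p+q), which is killed by t^p
   already; so [B] does not depend on the choice, hence is linear and commutes with [t]. *)
have Buniq y x : (t ^+ p) y = (t ^+ (p + q)) x -> B y = (t ^+ p.*2) x.
  move=> hx; apply/eqP; rewrite -subr_eq0 /B -bopB; apply/eqP.
  rewrite -addnn texp (@ascn q (h y - x)) ?bop0 //.
  by rewrite bopB -hx -hh1 subrr.
have hB : bounded_operator B.
  apply: (@mk_bop_subproof _ _ _ (opn (t ^+ p.*2) * C)) => [k x y|x].
    rewrite (Buniq _ (k *: h x + h y)); last by rewrite !bopD !bopZ -!hh1.
    by rewrite bopD bopZ.
  rewrite (le_trans (opnP _ _)) // -mulrA ler_wpM2l ?opn_ge0 //.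
  by have [] := hh x.
have tC k x : (t ^+ k) (t x) = t ((t ^+ k) x).
  by rewrite -[LHS]/((t ^+ k * t) x) -exprSr exprS.
exists p, B; split=> // x.
  by rewrite (Buniq (t x) (t (h x))) !tC ?hh1.
rewrite -!bop_expE hh1 /B -texp; congr ((t ^+ _) _).
by rewrite /q addSn !addnS.
Qed.

(** On the range of T^n the restriction carries the higher powers of T, so its ascent and descent
    bounds become bounds for T after adding n. *)
Lemma B_BrowderP (T : X -> X) : bounded_operator T -> B_Browder T <-> op_drazin T.
Proof.
move=> hT; pose t := Bop hT; split; last exact: (@drazin_B_Browder t).
move=> [n [M [TM [MT [_ [a asc] [b desc]]]]]].
have MP x : x \in M <-> range (iter n T) x by rewrite -MT.
have TnM x : iter n T x \in M by apply/MP; exists x.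
pose w x : subsp M := exist (fun y => y \in M) _ (TnM x).
have iterT k x : iter (k + n) T x = val (iter k (restr TM) (w x)).
  by rewrite val_iter_restr iterD.
have ak : (a <= maxn a b)%N := leq_maxl a b.
have bk : (b <= maxn a b)%N := leq_maxr a b.
move: (maxn a b) ak bk => k ak bk.
apply: (@ascent_descent_drazin t (k + n)) => [x|y]; rewrite !bop_expE.
  rewrite -addSn -[bop_fun t]/T !iterT => h.
  have {h} : iter k.+1 (restr TM) (w x) = 0 by apply: val_inj.
  rewrite -(subnKC ak) -addSn !iterD => h.
  have : Defs.kernel (iter a.+1 (restr TM)) (iter (k - a) (restr TM) (w x)) by [].
  by rewrite -asc => h'; rewrite (h' : iter a _ _ = 0).
have : range (iter b (restr TM)) (iter b (restr TM) (w y)) by exists (w y).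
rewrite desc => -[v _ vE].
have /MP[x _ xE] := valP v.
exists x; rewrite bop_expE -addSn -[bop_fun t]/T !iterT.
have -> : w x = v by apply: val_inj.
by rewrite -(subnK bk) -addnS !iterD vE.
Qed.

End BrowderOperators.

(** * Polynomials of an operator *)

Section PolynomialCalculus.
Context {R : realType} {X : normedModType R[i]} {G : commuting X}.
Notation A := (bic G).
Notation sc := (bic_scalar G).
Context (u : A).

Definition peval (p : {poly R[i]}) : A := \sum_(i < size p) sc p`_i * u ^+ i.

Lemma peval_widen (p : {poly R[i]}) n : (size p <= n)%N ->
  peval p = \sum_(i < n) sc p`_i * u ^+ i.
Proof.
move=> pn; rewrite /peval (big_ord_widen n (fun i => sc p`_i * u ^+ i) pn) big_mkcond.
apply: eq_bigr => i _; case: ltnP => // /(nth_default 0) ->.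
by rewrite rmorph0 mul0r.
Qed.

Lemma pevalB (p q : {poly R[i]}) : peval (p - q) = peval p - peval q.
Proof.
rewrite !(@peval_widen _ (maxn (size p) (size q))) ?leq_maxl ?leq_maxr //.
  by rewrite -sumrB; apply: eq_bigr => i _; rewrite coefB rmorphB mulrBl.
by rewrite (leq_trans (size_polyD _ _)) // size_polyN.
Qed.

Lemma pevalZ k (p : {poly R[i]}) : peval (k *: p) = sc k * peval p.
Proof.
rewrite (peval_widen (size_scale_leq k p)) mulr_sumr.
by apply: eq_bigr => i _; rewrite coefZ rmorphM mulrA.
Qed.

Lemma pevalC k : peval k%:P = sc k.
Proof.
rewrite (peval_widen (size_polyC_leq1 k)) big_ord1 coefC eqxx expr0.
by rewrite mulr1.
Qed.

Lemma peval_mulX (p : {poly R[i]}) : peval (p * 'X) = peval p * u.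
Proof.
have h : (size (p * 'X)%R <= (size p).+1)%N.
  by rewrite (leq_trans (size_polyMleq _ _)) // size_polyX addn2.
rewrite (peval_widen h) big_ord_recl coefMX eqxx rmorph0 mul0r add0r.
rewrite mulr_suml; apply: eq_bigr => i _.
by rewrite coefMX /= exprSr mulrA.
Qed.

(** Multiplicativity is only needed for linear factors, as every polynomial over [R[i]] splits. *)
Lemma peval_mul_XsubC (p : {poly R[i]}) c :
  peval (p * ('X - c%:P)) = peval p * (u - sc c).
Proof.
rewrite mulrBr pevalB peval_mulX mulrBr [p * c%:P]mulrC mul_polyC pevalZ.
by rewrite [sc c * _]mulrC.
Qed.

Lemma peval_prod (s : seq R[i]) :
  peval (\prod_(z <- s) ('X - z%:P)) = \prod_(z <- s) (u - sc z).
Proof.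
elim: s => [|c s IH]; first by rewrite !big_nil -[1]/(1%:P) pevalC rmorph1.
by rewrite !big_cons mulrC peval_mul_XsubC IH mulrC.
Qed.

Lemma regular_scalar k : k != 0 -> regular (sc k).
Proof. by move=> k0; exists (sc k^-1); rewrite mulrC bic_scalarVl. Qed.

Lemma drazin_scalar k : drazin (sc k).
Proof.
have [->|k0] := eqVneq k 0; last exact/regular_drazin/regular_scalar.
by exists 1%N, 0; rewrite rmorph0 expr1 mulr0.
Qed.

Lemma drazinN (v : A) : drazin v -> drazin (- v).
Proof.
by move=> dv; rewrite -mulN1r -[1](rmorph1 sc) -rmorphN;
  exact: drazinM (drazin_scalar _) dv.
Qed.

Lemma coprimeMr (a b c : A) : (exists x y, x * a + y * b = 1) ->
  (exists x y, x * a + y * c = 1) -> exists x y, x * a + y * (b * c) = 1.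
Proof.
move=> [x [y h]] [x' [y' h']].
exists (x * x' * a + x * y' * c + y * b * x'), (y * y').
by rewrite -[RHS]mulr1 -{1}h -h'; ring.
Qed.

Lemma coprime_sym (a b : A) : (exists x y, x * a + y * b = 1) ->
  exists x y, x * b + y * a = 1.
Proof. by move=> [x [y h]]; exists y, x; rewrite addrC. Qed.

Lemma coprime_exp (a b : A) m n : (exists x y, x * a + y * b = 1) ->
  exists x y, x * a ^+ m + y * b ^+ n = 1.
Proof.
move=> h.
have hx (c d : A) k : (exists x y, x * c + y * d = 1) ->
    exists x y, x * c + y * d ^+ k = 1.
  move=> hcd; elim: k => [|k IH]; last by rewrite exprS; exact: coprimeMr.
  by exists 0, 1; rewrite mul0r add0r expr0 mulr1.
by apply/coprime_sym/hx/coprime_sym/hx.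
Qed.

Lemma coprime_prod (l : R[i]) (s : seq R[i]) : l \notin s ->
  exists x y, x * (u - sc l) + y * \prod_(z <- s) (u - sc z) = 1.
Proof.
elim: s => [|c s IH]; first by exists 0, 1; rewrite big_nil mul0r add0r mulr1.
rewrite inE negb_or => /andP[lc /IH h]; rewrite big_cons; apply: coprimeMr => //.
have cl0 : c - l != 0 by rewrite subr_eq0 eq_sym.
exists (sc (c - l)^-1), (- sc (c - l)^-1).
rewrite -[RHS](bic_scalarVl G cl0) rmorphB; ring.
Qed.

(** The factors of p - p(l) at the root l are gathered into one power, coprime to the rest; its
    exponent is positive, so [drazinX] descends to u - l. *)
Lemma peval_drazin (p : {poly R[i]}) (l : R[i]) : (1 < size p)%N ->
  drazin (peval p - sc p.[l]) -> drazin (u - sc l).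
Proof.
move=> p1; rewrite -pevalC -pevalB.
set q := p - _; have [s qE] := closed_field_poly_normal q.
have q0 : lead_coef q != 0.
  rewrite lead_coef_eq0 subr_eq0; apply: contraTneq p1 => ->.
  by rewrite -leqNgt size_polyC_leq1.
have ls : l \in s.
  have : root q l by rewrite /root /q !hornerE subrr.
  by rewrite qE rootZ // root_prod_XsubC.
rewrite {1}qE pevalZ peval_prod => dq.
have {dq} : drazin (\prod_(z <- s) (u - sc z)).
  have := drazinM (drazin_scalar (lead_coef q)^-1) dq.
  by rewrite mulrA bic_scalarVl // mul1r.
rewrite (bigID (fun z => z == l)) /=.
have -> : \prod_(z <- s | z == l) (u - sc z) = (u - sc l) ^+ count_mem l s.
  rewrite (eq_bigr (fun=> u - sc l)); last by move=> z /eqP ->.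
  by rewrite big_const_seq iter_mulr_1.
rewrite -[\prod_(z <- s | z != l) _]big_filter.
set s' := [seq _ <- _ | _] => d; have ls' : l \notin s'.
  by rewrite mem_filter eqxx.
have ct : (0 < count_mem l s)%N by rewrite -has_count has_pred1.
rewrite -(prednK ct) in d; apply: (@drazinX _ _ (count_mem l s).-1).
apply: drazin_coprime_factor d => m n; rewrite -exprM.
exact/coprime_exp/coprime_prod.
Qed.

(** The polynomial vanishes on [s], so no root of it minus [c] lies in [s]. The added root 0 keeps
    it non-constant when [s] is empty. *)
Lemma peval_prod_drazin (s : seq R[i]) (c : R[i]) : c != 0 ->
  (forall z, z \notin s -> drazin (u - sc z)) ->
  drazin (peval (\prod_(z <- 0 :: s) ('X - z%:P)) - sc c).
Proof.
move=> c0 hs; set p := \prod_(z <- _) _; rewrite -pevalC -pevalB.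
have [r qE] := closed_field_poly_normal (p - c%:P).
rewrite qE pevalZ peval_prod; apply: drazinM (drazin_scalar _) _.
rewrite big_seq; apply: (big_ind drazin) => [||z zr].
- by apply: regular_drazin; exists 1; rewrite mulr1.
- by move=> *; exact: drazinM.
apply: hs; apply: contra c0 => zs.
have : root (p - c%:P) z.
  rewrite qE /root hornerZ.
  by have /eqP -> : root (\prod_(z <- r) ('X - z%:P)) z;
     rewrite ?root_prod_XsubC ?mulr0.
have : root p z by rewrite root_prod_XsubC inE zs orbT.
rewrite /root !hornerE => /eqP ->.
by rewrite sub0r oppr_eq0.
Qed.

End PolynomialCalculus.

(** * Kato-meromorphic decompositions *)

Section SpectralSeparation.
Context {R : realType} {X : completeNormedModType R[i]} {G : commuting X}.
Notation A := (bic G).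
Notation sc := (bic_scalar G).

Lemma avoid_seq (s : seq R) (a b : R) : a < b ->
  exists2 r, a <= r <= b & r \notin s.
Proof.
move=> ab; suff [c [d [ac cd db h]]] : exists c d, [/\ a <= c, c < d, d <= b &
    forall r, c <= r <= d -> r \notin s].
  exists c; last by apply: h; rewrite lexx ltW.
  by rewrite ac (le_trans (ltW cd)).
elim: s => [|x s [c [d [ac cd db h]]]]; first by exists a, b.
have [xm|mx] := leP x ((c + d) / 2).
  exists ((c + d) / 2 + (d - c) / 4), d; split; try lra.
  move=> r /andP[r1 r2]; rewrite inE negb_or h ?andbT; last by apply/andP; split; lra.
  by apply/eqP; lra.
exists c, ((c + d) / 2); split; try lra.
move=> r /andP[r1 r2]; rewrite inE negb_or h ?andbT; last by apply/andP; split; lra.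
by apply/eqP; lra.
Qed.

Lemma isolate_zero (s : seq R[i]) :
  exists2 e : R, 0 < e & forall w, 0 < rnorm w <= e -> w \notin s.
Proof.
elim: s => [|x s [e e0 h]]; first by exists 1.
have [->|x0] := eqVneq x 0.
  exists e => // w /andP[w0 we]; rewrite inE negb_or h ?w0 // andbT.
  by rewrite -rnorm_gt0.
have nx : 0 < rnorm x by rewrite rnorm_gt0.
have m0 : 0 < Num.min e (rnorm x / 2) by rewrite lt_min e0 divr_gt0.
exists (Num.min e (rnorm x / 2)) => // w /andP[w0]; rewrite le_min => /andP[w1 w2].
rewrite inE negb_or h ?w0 // andbT; apply/eqP => wx; move: w2; rewrite wx.
by lra.
Qed.

(* Outside a finite set all points are poles or regular, hence isolated in the
   spectrum; so some small circle around 0 avoids the spectrum, and the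
   corresponding Riesz projection splits off the part of a near 0. *)
Lemma separate_zero (a : A) (s : seq R[i]) :
  (forall w, w \notin s -> drazin (a - sc w)) ->
  exists p d : A, [/\ p * p = p, a * d = 1 - p &
    forall w, w != 0 -> drazin (a * p - sc w)].
Proof.
move=> hs; have [e e0 he] := isolate_zero s.
(* Asking for regularity only in an annulus makes the condition vacuous near 0, where 0 itself may
   belong to [s]. *)
pose Q w := e / 2 <= rnorm w <= e -> regular (a - sc w).
have : finite_set [set z | rnorm z <= e /\ ~ Q z].
  apply: finite_exceptional => z.
  have [z0|z0] := eqVneq z 0.
    exists (e / 2) => [|w /andP[_]]; first by rewrite divr_gt0.
    by rewrite z0 subr0 => we /andP[]; rewrite leNgt we.
  have nz : 0 < rnorm z by rewrite rnorm_gt0.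
  have [ze|ez] := leP (rnorm z) e.
    have [e' e'0 h] : exists2 e' : R, 0 < e' & forall w, 0 < rnorm w < e' ->
        regular (a - sc z - sc w).
      by apply: drazin_punctured_regular; apply: hs; apply: he; rewrite nz.
    exists e' => // w /h; rewrite rmorphB /= => hw _.
    by move: hw; rewrite opprB addrA subrK.
  exists (rnorm z - e) => [|w /andP[_ wz] /andP[_ we]]; first by rewrite subr_gt0.
  have := rnormD_le (z - w) w; rewrite subrK rnormB; lra.
case/finite_seqP => bad badE.
have [|r /andP[r1 r2] rb] := @avoid_seq (map rnorm bad) (e / 2) e; first by lra.
have r0 : 0 < r by apply: lt_le_trans r1; rewrite divr_gt0.
have [|p [d [pp ad reg]]] := @riesz_projection _ _ _ a r r0.
  move=> z zr; apply: contrapT => nz; move/negP: rb; apply.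
  have : [set` bad] z.
    rewrite -badE; split; first by rewrite zr.
    by move=> Qz; apply: nz; apply: Qz; rewrite zr r1.
  by move=> /= zb; rewrite -zr; exact: map_f.
exists p, d; split=> // w w0.
have [rw|wr] := leP r (rnorm w); first exact/regular_drazin/reg.
(* Inside the circle, a p - w is a - w on the range of p and the scalar -w on its kernel. *)
apply: (drazin_split (a := a - sc w) (b := - sc w) pp); first by ring.
  by apply: hs; apply: he; rewrite rnorm_gt0 w0 (le_trans (ltW wr)).
exact/drazinN/drazin_scalar.
Qed.

Lemma regular_large (a : A) w : bnorm a < rnorm w -> regular (a - sc w).
Proof.
move=> aw; have w0 : 0 < rnorm w by rewrite (le_lt_trans _ aw) // bnorm_ge0.
have wn : w != 0 by rewrite -rnorm_gt0.
have ww := bic_scalarVl G wn.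
have [|g hg _] := @neumann _ _ _ (sc w^-1 * a).
  rewrite (le_lt_trans (bnormZ _ _)) // rnormV mulrC ltr_pdivrMr ?mul1r //.
exists (- (sc w^-1 * g)).
have -> : (a - sc w) * - (sc w^-1 * g) = (sc w^-1 * sc w) * g - sc w^-1 * a * g.
  by ring.
by rewrite ww -mulrBl.
Qed.

End SpectralSeparation.

(** * Kato operators that are limits of invertible operators *)

Section KatoOperators.
Context {R : realType} {Y : completeNormedModType R[i]}.

Lemma regular_bounded_inverse (U : bop Y) z :
  (exists S, bounded_inverse (shift_op U z) S) <->
  regular (bic1 U - bic_scalar (commuting1 U) z).
Proof. by rewrite regularP. Qed.

(** For the partial sums s_n of the series of z^k x_k, (U - z) s_n = -z^(n+1) x_n tends to 0, hence
    so does s_n; but s_n stays within a third of the norm of x_0 from x_0. *)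
Lemma Kato_injective (U : bop Y) (C : R) : 0 < C ->
  (forall y, range U y -> exists2 x, y = U x & rnorm x <= C * rnorm y) ->
  (forall n : nat, Defs.kernel U `<=` range (iter n U)) ->
  (forall e : R, 0 < e -> exists2 z, rnorm z < e &
     exists S, bounded_inverse (shift_op U z) S) ->
  forall x, U x = 0 -> x = 0.
Proof.
move=> C0 hC kerU hz x0 Ux0.
(* This makes the series decay with ratio at most 1/4, and the terms after x_0 sum to at most 1/3 of
   its norm. *)
have Cinv : 0 < (4 * C)^-1 by rewrite invr_gt0 mulr_gt0.
have [z zC [S [hS SU US]]] := hz _ Cinv.
have [h hh] : exists h : Y -> Y, forall y, range U y ->
    y = U (h y) /\ rnorm (h y) <= C * rnorm y.
  have /choice[h hh] y : exists x, range U y -> y = U x /\ rnorm x <= C * rnorm y.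
    have [/hC[x yx xC]|ny] := pselect (range U y); first by exists x.
    by exists 0.
  by exists h.
pose x := fix x k : Y := if k is j.+1 then h (x j) else x0.
(* An arbitrary preimage differs from a preimage in the range of U^n by a kernel vector, which lies
   in that range too; so the bounded selection [h] can be iterated. *)
have xr k n : range (iter n U) (x k).
  elim: k n => [|k IH] n; first exact: kerU.
  have [w _ wE] := IH n.+1; have [xU _] := hh _ (IH 1%N).
  have kx : Defs.kernel U (x k.+1 - iter n U w).
    by rewrite /Defs.kernel /= bopB -xU -wE iterS subrr.
  have [v _ vE] := kerU n _ kx; exists (v + w) => //.
  by rewrite -!bop_expE bopD !bop_expE vE subrK.
have xU k : x k = U (x k.+1) by have [] := hh _ (xr k 1%N).
have xn k : rnorm (x k) <= C ^+ k * rnorm x0.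
  elim: k => [|k IH]; first by rewrite expr0 mul1r.
  have [_ h1] := hh _ (xr k 1%N); apply: le_trans h1 _.
  by rewrite exprS -mulrA ler_wpM2l // ltW.
pose s n := \sum_(k < n.+1) z ^+ k *: x k.
have zC1 : rnorm z * C <= 1 / 4.
  move: zC; rewrite -[(4 * C)^-1]mul1r ltr_pdivlMr ?mulr_gt0 //; lra.
have term n : rnorm (z ^+ n *: x n) <= (1 / 4) ^+ n * rnorm x0.
  rewrite rnormZ rnormX (le_trans (ler_wpM2l _ (xn n))) ?exprn_ge0 ?rnorm_ge0 //.
  rewrite mulrA -exprMn ler_wpM2r ?rnorm_ge0 // lerXn2r ?nnegrE ?divr_ge0 //.
  by rewrite mulr_ge0 ?rnorm_ge0 // ltW.
have hq : 0 <= (1 / 4 : R) < 1 by apply/andP; split; lra.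
have step n : rnorm (s n.+1 - s n) <= (1 / 4 * rnorm x0) * (1 / 4) ^+ n.
  rewrite /s big_ord_recr /= [X in X - _]addrC addrK.
  by rewrite (le_trans (term _)) // exprS le_eqVlt; apply/orP; left; apply/eqP; ring.
have s0 n : rnorm (s n - x0) <= rnorm x0 / 3.
  have := geometric_dist hq step (leq0n n).
  rewrite {2}/s big_ord1 expr0 scale1r mulr1 (_ : _ / (1 - 1 / 4) = rnorm x0 / 3) //.
  by field.
have Us n : shift_op U z (s n) = - (z ^+ n.+1 *: x n).
  rewrite /shift_op; elim: n => [|n IH].
    by rewrite /s !big_ord1 expr0 expr1 !scale1r Ux0 sub0r.
  have -> : s n.+1 = s n + z ^+ n.+1 *: x n.+1 by rewrite /s big_ord_recr.
  rewrite bopD scalerDr opprD addrACA IH bopZ -xU addrA addNr add0r.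
  by rewrite scalerA -exprS.
have [_ [k k0 hk]] : bounded_linear S by exact: (bounded_linear_bop (Bop hS)).
have sn n : rnorm (s n) <= (k * rnorm z * rnorm x0) * (1 / 4) ^+ n.
  rewrite -[s n]SU Us (le_trans (hk _)) // rnormN exprS -scalerA rnormZ.
  rewrite -!mulrA ler_wpM2l // ler_wpM2l ?rnorm_ge0 //.
  by rewrite mulrC [leRHS]mulrC mulrC; apply: le_trans (term n) _; rewrite mulrC.
apply: rnorm0_eq0.
have : rnorm x0 * (2 / 3) <= 0.
  apply: (@le0_geometric _ _ _ _ hq) => n; apply: le_trans (sn n).
  have := s0 n; have := rnorm_dist x0 (s n) 0; rewrite !subr0 rnormB; lra.
lra.
Qed.

(** Closed range and injectivity bound U below. The inverses of U - z are then bounded uniformly for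
    small z, and U is a small perturbation of U - z. *)
Lemma Kato_inverse (U : bop Y) : Kato U ->
  (forall e : R, 0 < e -> exists2 z, rnorm z < e &
     exists S, bounded_inverse (shift_op U z) S) ->
  exists S, bounded_inverse U S.
Proof.
move=> [clU kerU] hz.
pose Z : set Y := [set x | exists y1 y2, x = U y1 + (0 : bop Y) y2].
have ZE : Z = range U.
  apply/seteqP; split=> x [y]; last by move=> _ <-; exists y, 0; rewrite bop_zeroE addr0.
  by move=> [v ->]; exists y; rewrite // bop_zeroE addr0.
have [C C0 hC] := open_mapping (bounded_linear_bop U) (bounded_linear_bop 0)
  (eq_ind_r closed clU ZE).
have hC1 y : range U y -> exists2 x, y = U x & rnorm x <= (C + 1) * rnorm y.
  rewrite -ZE => /hC[x [v [yE xC _]]]; exists x.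
    by rewrite yE bop_zeroE addr0.
  by rewrite (le_trans xC) // ler_wpM2r ?rnorm_ge0 // lerDl.
have C1 : 0 < C + 1 by lra.
have inj := Kato_injective C1 hC1 kerU hz.
have low x : rnorm x <= (C + 1) * rnorm (U x).
  have [|x' Ux x'C] := hC1 (U x); first by exists x.
  suff xx' : x = x' by rewrite {1}xx'.
  by apply/eqP; rewrite -subr_eq0; apply/eqP/inj; rewrite bopB Ux subrr.
(* It yields [bnorm g <= 2 * (C + 1)], so that |z| times this bound is below 1/2. *)
have e0 : 0 < (4 * (C + 1))^-1 by rewrite invr_gt0 mulr_gt0.
have [z zC] := hz _ e0; move=> /regular_bounded_inverse[g zg].
have zC1 : rnorm z * (C + 1) < 1 / 4.
  move: zC; rewrite -[(4 * _)^-1]mul1r ltr_pdivlMr ?mulr_gt0 //; lra.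
have gb : bnorm g <= 2 * (C + 1).
  apply: opn_le; first by rewrite mulr_ge0 // ltW.
  move=> y; set x := g y.
  have yE : U x - z *: x = y.
    have /(congr1 val) := zg; rewrite rmorphM /= => h.
    by rewrite -[LHS]/((bic_val (bic1 U - bic_scalar _ z) * bic_val g) y) h.
  have h1 := low x; have h2 := rnormD_le y (z *: x).
  have h3 : y + z *: x = U x by rewrite -yE subrK.
  rewrite h3 rnormZ in h2.
  have h4 := rnorm_ge0 x.
  have h5 : (C + 1) * rnorm (U x) <= (C + 1) * (rnorm y + rnorm z * rnorm x).
    by rewrite ler_wpM2l // ltW.
  move: h1 h5 h4 zC1 C1 (rnorm_ge0 z); move: (rnorm x) (rnorm y) (rnorm z) (rnorm (U x)).
  by clear; move=> a b c d; nra.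
have bz : bnorm (- bic_scalar (commuting1 U) z) <= rnorm z.
  rewrite bnormN -[bic_scalar _ z]mulr1 (le_trans (bnormZ _ _)) //.
  rewrite ler_piMr ?rnorm_ge0 //; exact: opn1.
have [|h hU _] := regular_sub zg (b := - bic_scalar _ z).
  have := bnorm_ge0 g; have := bnorm_ge0 (- bic_scalar (commuting1 U) z).
  move: gb bz zC1 (rnorm_ge0 z); do !move: (bnorm _) => ?; nra.
have /regularP : regular (bic1 U) by exists h; rewrite -hU opprK subrK.
by [].
Qed.

End KatoOperators.

(** * Splittings into an invertible and a meromorphic part *)

Lemma op_drazinN (R : realType) (X : normedModType R[i]) (U : bop X) :
  op_drazin U -> op_drazin (- U).
Proof.
by move=> /(bic_drazinP (bic1 U))/drazinN/(bic_drazinP (- bic1 U)).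
Qed.

Lemma op_drazin_scalar (R : realType) (X : normedModType R[i]) (c : R[i]) :
  c != 0 -> op_drazin (c *: (1 : bop X)).
Proof.
move=> c0; apply: (op_drazin_inverse (S := c^-1 *: (1 : bop X))).
split; first exact: bopP.
  by move=> x; rewrite !bop_scaleE !bop_oneE scalerA mulVf // scale1r.
by move=> x; rewrite !bop_scaleE !bop_oneE scalerA divff // scale1r.
Qed.

Section Splittings.
Context {R : realType} {X : completeNormedModType R[i]}.
Implicit Types (U : bop X) (T : X -> X) (M N : closed_subspace X).

(** The common ground of the two spectra: equivalent to generalized Drazin-meromorphic
    invertibility, and to the Kato version at limits of resolvent points. *)
Definition invertible_meromorphic_split T :=
  exists M N (TM : Defs.invariant T M) (TN : Defs.invariant T N),
  [/\ direct_sum M N, exists S, bounded_inverse (restr TM) S &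
     meromorphic (restr TN)].

Lemma split_gK T : invertible_meromorphic_split T -> gK_meromorphic_decomposable T.
Proof.
move=> [M [N [TM [TN [MN [S [hS Sl Sr]] mN]]]]]; exists M, N, TM, TN; split=> //.
split.
  rewrite (_ : range _ = setT); first exact: closedT.
  by apply/seteqP; split=> // x _; exists (S x).
move=> n x; rewrite /Defs.kernel /= => x0.
have S0 : S 0 = 0 := bop0 (Bop hS).
exists x => //; have -> : x = 0 by rewrite -[x]Sl x0 S0.
have r0 : restr TM 0 = 0 by rewrite -[RHS]Sr S0.
by elim: n => //= n ->.
Qed.

(** Here p = U S is idempotent; U is inverted by S on its range, and on its kernel U S U - U is
    -U. *)
Lemma gD_split U : gD_meromorphic_invertible U -> invertible_meromorphic_split U.
Proof.
move=> [S0 [hS US SUS]]; pose S := Bop hS; pose W : bop X := U * S * U - U => mW.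
have cUS : U * S = S * U by apply: bopE => x; exact: US.
pose G := commuting2 cUS.
pose u : bic G := @bic_gen _ _ G U (or_introl erefl).
pose s : bic G := @bic_gen _ _ G S (or_intror erefl).
pose p := u * s.
have sus : s * u * s = s by apply/val_inj/bopE => x; exact: SUS.
have pp : p * p = p by rewrite /p -{3}sus; ring.
have comm (a : bic G) : Defs.invariant U (kernel_subspace a).
  by apply: kernel_invariant; have := congr1 val (mulrC a u); rewrite !rmorphM.
pose M := kernel_subspace (1 - p); pose N := kernel_subspace p.
have inM x : x \in M <-> bic_val p x = x.
  split=> [/kernel_subspaceP h|px].
    by apply/eqP; rewrite eq_sym -subr_eq0; apply/eqP.
  by apply/kernel_subspaceP; rewrite -[LHS]/(x - bic_val p x) px subrr.
have mulE (a b c : bic G) x : a = b * c -> bic_val a x = bic_val b (bic_val c x).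
  by move=> ->.
have pE x : bic_val p x = U (S x) by [].
have pE' x : bic_val p x = S (U x) by rewrite pE US.
have sM x : S x \in M by apply/inM; rewrite pE' -[U (S x)]/(U (S0 x)); exact: SUS.
exists M, N, (comm (1 - p)), (comm p); split.
- split=> [x|x /inM px /kernel_subspaceP x0]; last by rewrite -px.
  exists (bic_val p x), (x - bic_val p x); split; last by rewrite addrC subrK.
    by apply/inM; rewrite -(mulE p p p).
  by apply/kernel_subspaceP; rewrite bopB -(mulE p p p) // subrr.
- have SM : Defs.invariant S M by move=> x _; exact: sM.
  exists (restr SM); split; first exact: restr_bounded.
    by move=> x; apply: val_inj; rewrite !val_restr -pE'; apply/inM/valP.
  by move=> x; apply: val_inj; rewrite !val_restr -pE; apply/inM/valP.
have hU : bounded_operator U := bopP U.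
apply/meromorphicP => [|c c0]; first exact: restr_bounded.
(* On the kernel of p this is U - c, while globally it is -(W - (-c)), which is Drazin invertible as
   W is meromorphic. *)
pose v := u * (1 - p) - bic_scalar G c.
have dv : drazin v.
  have -> : v = - ((u * s * u - u) - bic_scalar G (- c)).
    by rewrite /v /p rmorphN; ring.
  apply: drazinN; apply: (bic_drazinP _).1.
  by apply: ((meromorphicP (bopP W)).1 mW); rewrite oppr_eq0.
have vN : Defs.invariant v N.
  by apply: kernel_invariant; have := congr1 val (mulrC p v); rewrite !rmorphM.
have := kernel_drazin vN dv.
suff -> : restr vN = shift_op (restr (comm p)) c by [].
apply/funext => x; apply: val_inj; rewrite val_restr.
rewrite -[RHS]/(U (val x) - c *: val x).
rewrite -[LHS]/(U (val x - bic_val p (val x)) - c *: val x).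
by have /kernel_subspaceP -> := valP x; rewrite subr0.
Qed.

(** S inverts U on M and vanishes on N, so U S U - U is 0 on M and -U on N. *)
Lemma split_gD U : invertible_meromorphic_split U -> gD_meromorphic_invertible U.
Proof.
move=> [M [N [TM [TN [MN [SM [hSM Sl Sr]] mN]]]]].
have [p [pM pN pMid pN0]] := direct_sum_projection MN.
have hU := bopP U.
pose P1 x : subsp M := exist (fun y => y \in M) (p x) (pM x).
have P1l k x y : P1 (k *: x + y) = k *: P1 x + P1 y.
  by apply: val_inj; rewrite valD valZ /= bopD bopZ.
pose sm := Bop hSM.
pose S x : X := val (sm (P1 x)).
have hS : bounded_operator S.
  apply: (@mk_bop_subproof _ _ _ (opn sm * opn p)) => [k x y|x].
    by rewrite /S P1l bopD bopZ valD valZ.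
  by rewrite rnorm_val (le_trans (opnP _ _)) // -mulrA ler_wpM2l ?opn_ge0 // opnP.
have US x : U (S x) = p x.
  by rewrite /S -(val_restr TM) Sr.
have Up x : p (U x) = U (p x).
  rewrite -{1}[x](subrK (p x)) addrC bopD bopD pMid; last exact: (TM _ (pM x)).
  by rewrite (pN0 (U (x - p x))) ?addr0 //; exact: (TN _ (pN x)).
have SU x : S (U x) = p x.
  rewrite /S (_ : P1 (U x) = restr TM (P1 x)) ?[sm _]Sl //.
  by apply: val_inj; rewrite val_restr /= Up.
have Sp x : S (p x) = S x.
  by rewrite /S; congr (val (sm _)); apply: val_inj => /=; rewrite pMid.
exists S; split=> // [x|x|]; first by rewrite US SU.
  by rewrite US Sp.
pose W : bop X := U * p - U.
suff : meromorphic W by congr meromorphic; apply/funext => x; rewrite SU.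
apply/meromorphicP => [|c c0]; first exact: bopP.
pose V : bop X := W - c *: (1 : bop X); rewrite -[shift_op W c]/(V : X -> X).
have VM x : x \in M -> V x = - c *: x.
  move=> xM; rewrite -[V x]/(U (p x) - U x - c *: x) pMid // subrr sub0r.
  by rewrite scaleNr.
have VN x : x \in N -> V x = - (U x - (- c) *: x).
  move=> xN; rewrite -[V x]/(U (p x) - U x - c *: x) pN0 // bop0 sub0r.
  by rewrite scaleNr opprK opprD.
have VMi : Defs.invariant V M by move=> x xM; rewrite VM // subspaceZ.
have VNi : Defs.invariant V N.
  move=> x xN; rewrite VN // -scaleN1r subspaceZ // subspaceB ?subspaceZ //.
  exact: (TN x xN).
apply: (direct_sum_drazin (TM := VMi) (TN := VNi) (bopP V) MN).
  have -> : restr VMi = (- c) *: (1 : bop (subsp M)).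
    by apply/funext => x; apply: val_inj; rewrite val_restr VM //; exact: valP.
  by apply: op_drazin_scalar; rewrite oppr_eq0.
have := (meromorphicP (restr_bounded TN hU)).1 mN (- c).
rewrite oppr_eq0 => /(_ c0).
pose w : bop (subsp N) := Bop (restr_bounded TN hU) - (- c) *: (1 : bop (subsp N)).
rewrite -[shift_op _ _]/(w : subsp N -> subsp N) => /op_drazinN.
suff -> : restr VNi = (- w : bop (subsp N)) by [].
by apply/funext => x; apply: val_inj; rewrite val_restr VN //; exact: valP.
Qed.

(** The inverse preserves M: if y is in M and S y = a + b, then T b = y - T a lies in both M and N,
    so it is 0. *)
Lemma direct_sum_restr_inverse T M N (TM : Defs.invariant T M) :
  Defs.invariant T N -> direct_sum M N ->
  (exists S, bounded_inverse T S) -> exists S, bounded_inverse (restr TM) S.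
Proof.
move=> TN [sp dj] [S [hS Sl Sr]].
have hT x y : T (x + y) = T x + T y.
  apply: (can_inj Sr).
  have bS := bopD (Bop hS) (T x) (T y); rewrite /= in bS.
  by rewrite Sl bS !Sl.
have SM : Defs.invariant S M.
  move=> y yM; have [a [b [aM bN Sy]]] := sp (S y).
  have Tb : T b = y - T a by rewrite -[y]Sr Sy hT addrC addKr.
  have /(congr1 S) : T b = 0.
    by apply: dj; [rewrite Tb subspaceB //; exact: (TM a aM)|exact: (TN b bN)].
  have T0 : S 0 = 0 := bop0 (Bop hS).
  by rewrite Sl T0 Sy => ->; rewrite addr0.
exists (restr SM); split; first exact: restr_bounded.
  by move=> x; apply: val_inj; rewrite !val_restr Sl.
by move=> x; apply: val_inj; rewrite !val_restr Sr.
Qed.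

Lemma op_drazin_punctured U : op_drazin U -> exists2 e : R, 0 < e &
  forall z, 0 < rnorm z < e -> exists S, bounded_inverse (shift_op U z) S.
Proof.
move=> /(bic_drazinP (bic1 U)) /drazin_punctured_regular [e e0 he].
by exists e => // z /he /regularP.
Qed.

End Splittings.

Lemma split_punctured (R : realType) (X : completeNormedModType R[i]) (U : bop X) :
  invertible_meromorphic_split U -> exists2 e : R, 0 < e &
  forall z, 0 < rnorm z < e -> op_drazin (shift_op U z).
Proof.
move=> [M [N [TM [TN [MN [S hS] mN]]]]].
have hU := bopP U.
have := op_drazin_inverse hS.
move=> /(@op_drazin_punctured _ _ (Bop (restr_bounded TM hU)))[e e0 he].
exists e => // z zr; have /andP[z0 _] := zr.
have zM := shift_invariant z TM; have zN := shift_invariant z TN.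
apply: (direct_sum_drazin (TM := zM) (TN := zN) (shift_bounded z hU) MN).
  have [S' hS'] := he z zr.
  by rewrite -(shift_restr TM); exact: op_drazin_inverse hS'.
rewrite -(shift_restr TN); apply: ((meromorphicP (restr_bounded TN hU)).1 mN).
by rewrite -rnorm_gt0.
Qed.

Lemma gK_split (R : realType) (X : completeNormedModType R[i]) (U : bop X) :
  (forall e : R, 0 < e -> exists2 z, rnorm z < e &
     exists S, bounded_inverse (shift_op U z) S) ->
  gK_meromorphic_decomposable U -> invertible_meromorphic_split U.
Proof.
move=> hz [M [N [TM [TN [MN kM mN]]]]]; exists M, N, TM, TN; split=> //.
have hU := bopP U.
apply: (@Kato_inverse _ _ (Bop (restr_bounded TM hU))) => // e e0.
have [z ze hS] := hz e e0; exists z => //.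
have zM := shift_invariant z TM; have zN := shift_invariant z TN.
have := direct_sum_restr_inverse zM zN MN hS.
by rewrite -(shift_restr TM).
Qed.

(** * The equivalences for a fixed operator *)

Section MainTheorem.
Context {R : realType} {X : completeNormedModType R[i]}.
Context (t : bop X).

Lemma shift_shift (l z : R[i]) :
  shift_op (t - l *: (1 : bop X)) z = shift_op t (l + z).
Proof. by apply/funext => x; rewrite shift_opD. Qed.

Lemma drazin_shiftP l :
  op_drazin (shift_op t l) <->
  drazin (bic1 t - bic_scalar (commuting1 t) l).
Proof. exact: (bic_drazinP (bic1 t - bic_scalar _ l)). Qed.

Lemma split_shift_punctured (l : R[i]) :
  invertible_meromorphic_split (shift_op t l) -> exists2 e : R, 0 < e &
  forall w, 0 < rnorm (w - l) < e -> op_drazin (shift_op t w).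
Proof.
move=> /(@split_punctured _ _ (t - l *: (1 : bop X)))[e e0 he].
exists e => // w /he; rewrite shift_shift.
by rewrite addrC subrK.
Qed.

Lemma gK_everywhere_split :
  (forall l, gK_meromorphic_decomposable (shift_op t l)) ->
  forall l, invertible_meromorphic_split (shift_op t l).
Proof.
move=> hK.
pose W : set R[i] := [set l | forall e : R, 0 < e -> exists2 w, rnorm (w - l) < e &
  exists S, bounded_inverse (shift_op t w) S].
have WS l : W l -> invertible_meromorphic_split (shift_op t l).
  move=> Wl; apply: (@gK_split _ _ (t - l *: (1 : bop X))) (hK l) => e e0.
  have [w wl hS] := Wl e e0; exists (w - l) => //.
  by rewrite shift_shift addrC subrK.
suff WT l : W l by move=> l; exact/WS/WT.
have [z0 hz0] : exists z0, forall w, rnorm (w - z0) < 1 ->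
    exists S, bounded_inverse (shift_op t w) S.
  pose b := bnorm (bic1 t).
  have b0 : 0 <= b by exact: bnorm_ge0.
  exists ((b + 1)%:C)%C => w w1.
  have /regularP : regular (bic1 t - bic_scalar (commuting1 t) w).
    apply: regular_large; have := rnormD_le (((b + 1)%:C)%C - w) w.
    rewrite subrK rnorm_real ger0_norm; last by lra.
    by rewrite rnormB -/b; lra.
  by [].
apply: (@clopen_plane R W z0) => [z Wz|z hz e e0|e e0].
(* Openness: every w near z other than z is a Drazin point, so w + c is in the resolvent set for all
   small real c > 0. *)
- have [e e0 he] := split_shift_punctured (WS z Wz).
  exists e => // w wz; have [->//|nwz] := eqVneq w z.
  have dw : op_drazin (shift_op t w).
    by apply: he; rewrite wz andbT rnorm_gt0 subr_eq0.
  move=> e' e'0.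
  have [d d0 hd] := @op_drazin_punctured _ _ (t - w *: (1 : bop X)) dw.
  pose c : R := Num.min d e' / 2.
  have m0 : 0 < Num.min d e' by rewrite lt_min d0.
  have c0 : 0 < c by rewrite divr_gt0.
  have cm : c < Num.min d e' by rewrite /c; lra.
  have rc : rnorm ((c%:C)%C) = c by rewrite rnorm_real gtr0_norm.
  exists (w + (c%:C)%C).
    by rewrite addrAC subrr add0r rc (lt_le_trans cm) // ge_min lexx orbT.
  rewrite -shift_shift; apply: hd; rewrite rc c0 (lt_le_trans cm) //.
  by rewrite ge_min lexx.
- have e2 : 0 < e / 2 by rewrite divr_gt0.
  have [w wz Ww] := hz _ e2; have [v vw hS] := Ww _ e2; exists v => //.
  by have := rnorm_dist v w z; lra.
- exists z0; first by rewrite subrr rnorm0.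
  by apply: hz0; rewrite subrr rnorm0 ltr01.
Qed.

Lemma split_everywhere_finite :
  (forall l, invertible_meromorphic_split (shift_op t l)) ->
  exists s : seq R[i], forall l, l \notin s -> op_drazin (shift_op t l).
Proof.
move=> hs; pose b := bnorm (bic1 t).
have : finite_set [set z | rnorm z <= b /\ ~ op_drazin (shift_op t z)].
  by apply: finite_exceptional => z; exact: split_shift_punctured.
case/finite_seqP => s sE; exists s => l ls; apply: contrapT => nl.
move/negP: ls; apply; have : [set` s] l by rewrite -sE; split=> //;
  rewrite leNgt; apply/negP => /regular_large /regular_drazin /drazin_shiftP.
by [].
Qed.

(** With a = T - l, the idempotent p carries the part of a near 0; d (1 - p) inverts a on the
    complement, and a S a - a = -a p is meromorphic. *)
Lemma finite_split (s : seq R[i]) :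
  (forall l, l \notin s -> op_drazin (shift_op t l)) ->
  forall l, invertible_meromorphic_split (shift_op t l).
Proof.
move=> hs l.
apply: (@gD_split _ _ (t - l *: (1 : bop X))).
pose a := bic1 t - bic_scalar (commuting1 t) l.
have [w|p [d [pp ad dr]]] := @separate_zero _ _ _ a [seq z - l | z <- s].
  move=> ws; have -> : a - bic_scalar _ w = bic1 t - bic_scalar _ (l + w).
    by rewrite /a rmorphD /=; ring.
  apply/drazin_shiftP/hs; apply: contra ws => lws.
  by apply/mapP; exists (l + w) => //; rewrite addrC addKr.
pose S := d * (1 - p).
have qq : (1 - p) * (1 - p) = 1 - p by rewrite mulrBr mulr1 mulrBl mul1r pp; ring.
have aS : a * S = 1 - p by rewrite /S mulrA ad qq.
exists (bic_val S); split; first exact: bopP.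
- by move=> x; have /(congr1 val) := mulrC a S; rewrite !rmorphM => h;
    rewrite -[LHS]/((bic_val a * bic_val S) x) h.
- move=> x; have : S * (a * S) = S by rewrite aS /S -mulrA qq.
  by move=> /(congr1 (fun b => bic_val b x)).
pose W := a * S * a - a.
suff : meromorphic (bic_val W) by [].
apply/meromorphicP => [|c c0]; first exact: bopP.
suff : drazin (W - bic_scalar _ c) by move/bic_drazinP.
have -> : W - bic_scalar _ c = - (a * p - bic_scalar _ (- c)).
  by rewrite /W aS rmorphN /=; ring.
by apply/drazinN/dr; rewrite oppr_eq0.
Qed.

Lemma poly_opE (p : {poly R[i]}) : poly_op p t = bic_val (peval (bic1 t) p).
Proof.
apply/funext => x; rewrite /peval bic_sumE; apply: eq_bigr => i _.
rewrite bic_scalarE -[RHS]/(p`_i *: (bic_val (bic1 t ^+ i) x)).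
have -> : bic_val (bic1 t ^+ i) = t ^+ i := rmorphXn val i (bic1 t).
by rewrite bop_expE.
Qed.

Lemma finite_polynomially_meromorphic (s : seq R[i]) :
  (forall l, l \notin s -> op_drazin (shift_op t l)) -> polynomially_meromorphic t.
Proof.
move=> hs; pose p := \prod_(z <- 0 :: s) ('X - z%:P).
exists p; split; first by rewrite size_prod_XsubC.
rewrite poly_opE; apply/meromorphicP => [|c c0]; first exact: bopP.
suff : drazin (peval (bic1 t) p - bic_scalar _ c) by move/bic_drazinP.
apply: peval_prod_drazin => // z zs; exact/drazin_shiftP/hs.
Qed.

(** The roots of p contain all bad points: where p(l) is non-zero, p(T) - p(l) is Drazin
    invertible. *)
Lemma polynomially_meromorphic_finite : polynomially_meromorphic t ->
  exists s : seq R[i], forall l, l \notin s -> op_drazin (shift_op t l).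
Proof.
move=> [p [p1 mp]].
have [s sE] := closed_field_poly_normal p.
exists s => l ls; apply/drazin_shiftP; apply: (peval_drazin p1).
have pl : p.[l] != 0.
  have : ~~ root p l.
    rewrite sE rootZ ?root_prod_XsubC // lead_coef_eq0 -size_poly_gt0.
    exact: leq_trans p1.
  by [].
have : meromorphic (bic_val (peval (bic1 t) p)) by rewrite -poly_opE.
move=> /(meromorphicP (bopP _)).1 /(_ _ pl) h.
exact: (bic_drazinP (peval (bic1 t) p - bic_scalar _ p.[l])).1 h.
Qed.

End MainTheorem.

Theorem theorem3p3 (R : realType) (X : completeNormedModType R[i])
    (X_infinite_dim : ~ finite_dim [set: X])
    (T : X -> X) (T_bounded : bounded_operator T) :
  [<-> gKM_spectrum T = set0;
       gDM_spectrum T = set0;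
       polynomially_meromorphic T;
       finite_set (BB_spectrum T)].
Proof.
pose t := Bop T_bounded.
have compl0 (P : R[i] -> Prop) : [set l | ~ P l] = set0 <-> forall l, P l.
  split=> [/seteqP[P0 _] l|Pl]; first by apply: contrapT => /P0.
  by apply/seteqP; split=> // l []; exact: Pl.
have gDs l : invertible_meromorphic_split (shift_op t l) <->
    gD_meromorphic_invertible (shift_op t l).
  by split=> [/(@split_gD _ _ (t - l *: (1 : bop X)))|
              /(@gD_split _ _ (t - l *: (1 : bop X)))].
(* One cycle through the four statements; the second and third implications and the last all pass
   through a finite list containing the bad points. *)
tfae=> [/compl0 hK|/compl0 hD|
        /(@polynomially_meromorphic_finite _ _ t)[s hs]|/finite_seqP[s sE]].
- by apply/compl0 => l; apply/gDs; exact: (@gK_everywhere_split _ _ t).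
- have [s hs] := @split_everywhere_finite _ _ t (fun l => (gDs l).2 (hD l)).
  exact: (@finite_polynomially_meromorphic _ _ t s hs).
- apply: (@sub_finite_set _ _ [set` s]); last exact: finite_seq.
  move=> l nl; apply: contrapT => /negP ls; apply: nl.
  by apply/(B_BrowderP (shift_bounded l T_bounded)); exact: hs.
have hs l : l \notin s -> op_drazin (shift_op t l).
  move=> /negP ls; apply/(B_BrowderP (shift_bounded l T_bounded)).
  by apply: contrapT => nl; apply: ls; have : [set` s] l by rewrite -sE.
by apply/compl0 => l; apply: split_gK; exact: (@finite_split _ _ t s hs).
Qed.
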